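(* Let $n\ge 3$ be an integer. As $B\to\infty$, $$N_{X_{n,\mathrm{reg}},H}(B) = \left(\sum_{x \in \mathbb{P}^2(\mathbb{Q}) \setminus \{a=c=0\}} \mathfrak{c}_x \right) B^{\frac{2n}{n+2}} + O(B),$$ where $X_{n,\mathrm{reg}}$ denotes the smooth locus of $X_n$ and $(a:c:z)$ are the homogeneous coordinates on $\mathbb{P}^2$. The values in the leading constant are $$\mathfrak{c}_x = \frac{1}{2}\cdot\frac{1}{\zeta(2)}\cdot\omega_{\infty,x},$$ where, assuming that $a,c,z$ are coprime integral coordinates for $x=(a:c:z)$, $$\omega_{\infty,x} = \iint_{\substack{|a^{n}w|,|c^{n}w|,|z^{n}w| \le 1\\ |b|,|(bc+z^{n+1}w)/a| \le 1}} \frac{1}{|a|} \,\mathrm{d} b\,\mathrm{d} w \quad\text{for } a\neq 0,$$ $$\omega_{\infty,x} = \iint_{\substack{|a^{n}w|,|c^{n}w|,|z^{n}w| \le 1\\ |(ad-z^{n+1}w)/c|,|d| \le 1}} \frac{1}{|c|} \,\mathrm{d} d\,\mathrm{d} w \quad\text{for } c\neq 0.$$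
   Context: $X_n=\{ad-bc-z^{n+1}=0\}\subseteq\mathbb{P}_{\mathbb{Q}}(1,n,1,n,1)$ is the hypersurface in the weighted projective space with weighted homogeneous coordinates $(a:b:c:d:z)$ of weights $1,n,1,n,1$; its singular locus is $X_n\cap\{a=c=z=0\}$. The anticanonical height $H\colon X_n(\mathbb{Q})\to\mathbb{R}_{>0}$ is $$H(a:b:c:d:z)=\left(\frac{\max\{|a^n|,|b|,|c^n|,|d|,|z^n|\}}{\gcd(a^n,b,c^n,d,z^n)}\right)^{\frac{n+2}{n}}$$ for integral coordinates $a,b,c,d,z\in\mathbb{Z}$. For $V\subseteq X_n$, $N_{V,H}(B)=\#\{x\in V(\mathbb{Q}):H(x)\le B\}$. *)

(* Defs.v *)
From HB Require Import structures.
From mathcomp Require Import all_boot all_order all_algebra all_field.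
From mathcomp Require Import finmap.
From mathcomp Require Import all_classical all_reals all_analysis.
Set Implicit Arguments.
Unset Strict Implicit.
Unset Printing Implicit Defensive.
Import Order.TTheory GRing.Theory Num.Theory.
Import numFieldNormedType.Exports.
Local Open Scope classical_set_scope.
Local Open Scope ring_scope.

(* The scaling factor ranges over the algebraic numbers: this is equality of
   geometric points. When the weights of the nonzero coordinates have a common
   factor, rational tuples may differ by an irrational factor only. *)
Definition wscaling (m : nat) (w : m.-tuple nat) (x y : m.-tuple rat) : Prop :=
  exists2 t : algC, t != 0 &
    forall i : 'I_m, ratr (tnth y i) = t ^+ tnth w i * ratr (tnth x i).

(* A rational point of P(w_0,...,w_(m-1)) is the set of its rational coordinate
   tuples. Every Galois-invariant geometric point has such a tuple, by Hilbert's
   Theorem 90 after dividing the weights of the nonzero coordinates by their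
   gcd. *)
Definition wpoint (m : nat) (w : m.-tuple nat) (x : m.-tuple rat) :
    set (m.-tuple rat) :=
  [set y | wscaling w x y].

Definition wproj (m : nat) (w : m.-tuple nat) : set (set (m.-tuple rat)) :=
  [set wpoint w x | x in [set x : m.-tuple rat | exists i, tnth x i != 0]].

(* X_n(Q); the coordinates are ordered (a : b : c : d : z). *)
Definition Xn (n : nat) : set (set (5.-tuple rat)) :=
  [set x | wproj [tuple 1%N; n; 1%N; n; 1%N] x /\
    forall a b c d z : rat, x [tuple a; b; c; d; z] ->
      a * d - b * c - z ^+ n.+1 = 0].

Definition Xn_sing (n : nat) : set (set (5.-tuple rat)) :=
  Xn n `&` [set x | forall a b c d z : rat, x [tuple a; b; c; d; z] ->
    [/\ a = 0, c = 0 & z = 0]].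

Definition Xn_reg (n : nat) : set (set (5.-tuple rat)) := Xn n `\` Xn_sing n.

Definition height_coords (R : realType) (n : nat) (a b c d z : int) : R :=
  ((Num.max `|a ^+ n| (Num.max `|b| (Num.max `|c ^+ n|
      (Num.max `|d| `|z ^+ n|))))%:~R
   / (gcdz (a ^+ n) (gcdz b (gcdz (c ^+ n) (gcdz d (z ^+ n)))))%:~R)
  `^ (n.+2%:R / n%:R).

(* [height_coords] takes the same value at all integral coordinates of a point,
   so the value selected by [get] is the only one. *)
Definition height (R : realType) (n : nat) (x : set (5.-tuple rat)) : R :=
  get [set h : R | exists a b c d z : int,
    x [tuple a%:~R; b%:~R; c%:~R; d%:~R; z%:~R] /\
    h = height_coords R n a b c d z].

Definition below (R : realType) (V : set (set (5.-tuple rat)))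
    (H : set (5.-tuple rat) -> R) (B : R) : set (set (5.-tuple rat)) :=
  V `&` [set x | H x <= B].

(* Equal to 0 if [below V H B] is infinite. *)
Definition Ncount (R : realType) (V : set (set (5.-tuple rat)))
    (H : set (5.-tuple rat) -> R) (B : R) : nat :=
  #|` fset_set (below V H B)|.

(* P^2(Q) minus {a = c = 0}, with coordinates (a : c : z). *)
Definition P2_minus : set (set (3.-tuple rat)) :=
  wproj [tuple 1%N; 1%N; 1%N] `\`
  [set x | forall a c z : rat, x [tuple a; c; z] -> a = 0 /\ c = 0].

Definition coprime_coords (x : set (3.-tuple rat)) (a c z : int) : Prop :=
  x [tuple a%:~R; c%:~R; z%:~R] /\ gcdz a (gcdz c z) = 1.

Definition plane_measure (R : realType) :=
  (@lebesgue_measure R \x @lebesgue_measure R)%E.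

(* The integration variables are (b, w). *)
Definition omega_a (R : realType) (n : nat) (a c z : R) : R :=
  \int[@plane_measure R]_(p in [set p : R * R |
    [/\ `|a ^+ n * p.2| <= 1, `|c ^+ n * p.2| <= 1, `|z ^+ n * p.2| <= 1,
        `|p.1| <= 1 & `|(p.1 * c + z ^+ n.+1 * p.2) / a| <= 1]])
    `|a|^-1.

(* The integration variables are (d, w). *)
Definition omega_c (R : realType) (n : nat) (a c z : R) : R :=
  \int[@plane_measure R]_(p in [set p : R * R |
    [/\ `|a ^+ n * p.2| <= 1, `|c ^+ n * p.2| <= 1, `|z ^+ n * p.2| <= 1,
        `|(a * p.1 - z ^+ n.+1 * p.2) / c| <= 1 & `|p.1| <= 1]])
    `|c|^-1.

Definition zeta (R : realType) (s : nat) : R :=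
  limn (series (fun k : nat => (k.+1%:R : R) ^- s)).

(* Lets the Landau notations be used at +oo. *)
Canonical pinfty_filter_on (R : numFieldType) : filter_on R :=
  FilterType (pinfty_nbhs R) _.

(* Main.v *)
Require Import Defs.
From HB Require Import structures.
From mathcomp Require Import all_boot all_order all_algebra all_field.
From mathcomp Require Import finmap.
From mathcomp Require Import all_classical all_reals all_analysis.
From mathcomp Require Import measurable_realfun.
From mathcomp Require Import zify ring lra.
Set Implicit Arguments.
Unset Strict Implicit.
Unset Printing Implicit Defensive.
Import Order.TTheory GRing.Theory Num.Theory.
Import numFieldNormedType.Exports.
Local Open Scope classical_set_scope.
Local Open Scope ring_scope.

(** The points of [X_n] with [a = c = 0] are the singular ones, because the equation
then forces [z = 0]. So the smooth rational points are fibred over the points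
[t = (a : c : z)] of the plane with [(a, c) <> 0], and the point is to count each
fibre with an error that can be summed over [t].

Fix coprime integral coordinates of [t], and let [M = max (|a|, |c|, |z|)],
[A = max (|a|, |c|)] and [g = gcd (a, c)]. The points over [t] are the
[(a : b / q : c : d / q : z)] with [(b, d, q)] primitive, [q > 0], in the lattice
[a d - b c = q z ^ (n + 1)] of rank two, and the height is the power of exponent
[(n + 2) / n] of [max (q M ^ n, |b|, |d|)] ([fibre_pt_inj], [Xn_regP],
[height_fibre_pt]). With [B = Y ^ (n + 2)], the height condition is that this maximum
is at most [s = Y ^ n], so that [B ^ (2 n / (n + 2)) = s ^ 2] and the error to be
achieved is [O (Y ^ (n + 2))].

Without the condition of primitivity, the lattice is cut into slices of constant [q].
Only the multiples of [g] occur as [q], and the points of a slice form an arithmetic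
progression in an interval, whose number is the normalized length of that interval up
to [1]. The sum of these lengths is a Riemann sum of a function that decreases with
[|q|] and whose integral is [omega] ([region_integral], [lattice_count_estimate]). It
differs from [s ^ 2 omega / 2] by at most one term, [2 s g / A], and also by at most
[s ^ 2 omega / 2 <= 4 s ^ 2 / M ^ (n + 1)]. Altogether the error is [fibre_error],
see [fibre_estimate].

The sum of [fibre_error] over all [t] is [O (Y ^ (n + 2))], for every [Y > 0]
([fibre_error_sum_le]). For [M > Y] only the convergent series of the [omega] remains.
For [M <= Y], the first of the two bounds on the Riemann sum alone would cost a
logarithm; the geometric mean [s Y (g / A) ^ (1 - 1 / n) M ^ (- 1 - 1 / n)] of the
two, up to a constant, does not: summed over [z] it gives
[s Y (g / A) ^ (1 - 1 / n) A ^ (- 1 / n)], and summed over [a] and [c] this is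
[O (s Y ^ 2)] because [g ^ (- 1 - 1 / n)] is summable.

Finally, primitive vectors are singled out by Moebius inversion, applied to the sum over
all [t] ([primitive_sum_moebius]). The [k]th term has [Y / k ^ (1 / n)] in place of
[Y], so the errors are summable over [k], and the main terms add up to the factor
[1 / zeta 2] ([sum_moebius_zeta2]). One of the two coprime coordinate vectors of each
point is chosen ([normalized]); the factor [1 / 2] in the constant appears because
only one of [v] and [- v] has [q > 0]. *)

(** * The Moebius function *)

Definition moebius (n : nat) : int :=
  if all (fun p => logn p n <= 1)%N (primes n) then (-1) ^+ size (primes n)
  else 0.

Lemma normr_moebius (n : nat) : `|moebius n| <= 1.
Proof.
rewrite /moebius; case: ifP => _; last by rewrite normr0.
by rewrite normrX normrN1 expr1n.
Qed.

Lemma moebius_square (p n : nat) :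
  prime p -> (0 < n)%N -> (p ^ 2 %| n)%N -> moebius n = 0.
Proof.
move=> pp n0 pn; rewrite /moebius ifF //; apply/negbTE/allPn; exists p.
  rewrite mem_primes pp n0 /=; apply: dvdn_trans pn.
  by rewrite dvdn_exp.
by move: pn; rewrite pfactor_dvdn // -ltnNge.
Qed.

Lemma moebius_primeM (p n : nat) :
  prime p -> (0 < n)%N -> ~~ (p %| n)%N -> moebius (p * n) = - moebius n.
Proof.
move=> pp n0 pn.
have p0 : (0 < p)%N := prime_gt0 pp.
have eqp : perm_eq (primes (p * n)) (p :: primes n).
  apply: uniq_perm; rewrite ?primes_uniq //=.
    by rewrite primes_uniq mem_primes pp n0 (negbTE pn).
  by move=> q; rewrite primesM // primes_prime // !inE.
have npn : p \notin primes n by rewrite mem_primes pp n0 (negbTE pn).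
rewrite /moebius (perm_all _ eqp) (perm_size eqp) /=.
rewrite lognM // (logn_prime p pp) eqxx /= lognE pp n0 (negbTE pn) /=.
have -> : all (fun q => logn q (p * n) <= 1)%N (primes n) =
          all (fun q => logn q n <= 1)%N (primes n).
  apply: eq_in_all => q qn; rewrite lognM // (logn_prime q pp).
  by case: eqP qn => [->|_ _]; rewrite ?(negbTE npn).
by case: ifP => _; rewrite ?oppr0 // exprS mulN1r.
Qed.

(** Multiplication by the least prime divisor of [n] pairs the divisors that it
does not divide with those that it divides exactly once, and reverses signs. *)
Lemma sum_moebius (n : nat) : (0 < n)%N ->
  \sum_(k <- divisors n) moebius k = (n == 1)%:R.
Proof.
move=> n0; case: (altP (n =P 1%N)) => [->|n1].
  by rewrite big_cons big_nil addr0.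
have n2 : (1 < n)%N by case: n n0 n1 => [|[]].
set p := pdiv n.
have pp : prime p by apply: pdiv_prime.
have p0 : (0 < p)%N := prime_gt0 pp.
have pdn : (p %| n)%N by apply: pdiv_dvd.
rewrite (bigID (fun k => p %| k)%N) /= (bigID (fun k => p ^ 2 %| k)%N) /=.
rewrite big1_seq ?add0r; last first.
  move=> k /andP[/andP[_ p2k]]; rewrite -dvdn_divisors // => kn.
  by apply: (moebius_square pp) => //; apply: dvdn_gt0 kn.
rewrite -[X in X + _]big_filter.
have eqp : perm_eq [seq i <- divisors n | (p %| i)%N & ~~ (p ^ 2 %| i)%N]
   [seq (p * k)%N | k <- [seq k <- divisors n | ~~ (p %| k)%N]].
  apply: uniq_perm; rewrite ?filter_uniq ?divisors_uniq //.
    rewrite map_inj_uniq ?filter_uniq ?divisors_uniq //.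
    by move=> x y /eqP; rewrite eqn_pmul2l // => /eqP.
  move=> i; rewrite mem_filter -dvdn_divisors //; apply/idP/mapP.
    move=> /andP[/andP[/dvdnP[k ->]] npk kn]; exists k; last by rewrite mulnC.
    rewrite mem_filter -dvdn_divisors // (dvdn_trans _ kn) ?dvdn_mulr // andbT.
    by apply: contra npk => pk; rewrite expnS expn1 dvdn_mul.
  move=> [k]; rewrite mem_filter -dvdn_divisors // => /andP[npk kn] ->.
  rewrite dvdn_mulr //= expnS expn1 dvdn_pmul2l // npk /=.
  by rewrite Gauss_dvd ?pdn ?kn // prime_coprime.
rewrite (perm_big _ eqp) /= big_map big_filter -big_split /= big1_seq //.
move=> k /andP[npk]; rewrite -dvdn_divisors // => kn.
by rewrite moebius_primeM ?addNr //; apply: dvdn_gt0 kn.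
Qed.

Lemma sum_moebius_dvd (n N : nat) : (0 < n <= N)%N ->
  \sum_(1 <= k < N.+1 | (k %| n)%N) moebius k = (n == 1)%:R.
Proof.
move=> /andP[n0 nN]; rewrite -sum_moebius // -big_filter.
apply: perm_big; apply: uniq_perm.
- by rewrite filter_uniq // iota_uniq.
- exact: divisors_uniq.
move=> k; rewrite mem_filter -dvdn_divisors // mem_index_iota.
case kn : (k %| n)%N => //=.
by rewrite (dvdn_gt0 n0 kn) /= ltnS (leq_trans (dvdn_leq n0 kn)).
Qed.

(** * Roots of natural numbers and convergent sums *)

Definition nroot (R : realType) (n k : nat) : R := k%:R `^ n%:R^-1.

Lemma nroot_ge0 (R : realType) (n k : nat) : 0 <= nroot R n k.
Proof. exact: powR_ge0. Qed.

Lemma nroot_gt0 (R : realType) (n k : nat) : (0 < k)%N -> 0 < nroot R n k.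
Proof. by move=> k0; rewrite powR_gt0 // ltr0n. Qed.

Lemma nrootX (R : realType) (n k : nat) : (0 < n)%N -> nroot R n k ^+ n = k%:R.
Proof.
move=> n0; rewrite -powR_mulrn ?nroot_ge0 // -powRrM mulVf ?powRr1 //.
by rewrite pnatr_eq0 -lt0n.
Qed.

Lemma ler_nroot (R : realType) (n k l : nat) :
  (k <= l)%N -> nroot R n k <= nroot R n l.
Proof.
move=> kl; apply: ge0_ler_powR; rewrite ?nnegrE ?invr_ge0 ?ler0n //.
by rewrite ler_nat.
Qed.

Lemma nroot_ge1 (R : realType) (n k : nat) : (0 < k)%N -> 1 <= nroot R n k.
Proof.
by move=> k0; have := ler_nroot R n k0; rewrite {1}/nroot powR1.
Qed.

Lemma subrXX_le (R : realType) (n : nat) (x y : R) : 0 <= y -> y <= x ->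
  x ^+ n.+1 - y ^+ n.+1 <= n.+1%:R * (x - y) * x ^+ n.
Proof.
move=> y0 yx; have x0 : 0 <= x by apply: le_trans yx.
rewrite subrXX [n.+1%:R * _]mulrC -mulrA; apply: ler_wpM2l.
  by rewrite subr_ge0.
rewrite mulr_natl -[n.+1 in leRHS]card_ord -sumr_const ler_sum // => i _.
rewrite -[in leRHS](subnK (ltn_ord i : i <= n)%N) exprD.
by rewrite ler_wpM2l ?exprn_ge0 // lerXn2r.
Qed.

(** By the mean value inequality for [x ^ (n + 1)], consecutive roots of integers
differ by at least [1 / ((n + 1) x ^ n)]; this makes the terms of exponent
[1 + 1 / (n + 1)] telescope. *)
Lemma invr_nroot_telescope (R : realType) (n k : nat) : (0 < k)%N ->
  (k.+1%:R * nroot R n.+1 k.+1)^-1 <=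
  n.+1%:R * ((nroot R n.+1 k)^-1 - (nroot R n.+1 k.+1)^-1).
Proof.
move=> k0; set x := nroot R n.+1 k.+1; set y := nroot R n.+1 k.
have x0 : 0 < x by apply: nroot_gt0.
have y0 : 0 < y by apply: nroot_gt0.
have yx : y <= x by apply: ler_nroot.
have H : 1 <= n.+1%:R * (x - y) * x ^+ n.
  apply: le_trans (subrXX_le n (ltW y0) yx).
  by rewrite !nrootX // -natrB // subSnn.
rewrite -[k.+1%:R](@nrootX R n.+1) // -/x.
have -> : y^-1 - x^-1 = (x - y) / (x * y).
  by field; rewrite !gt_eqF.
rewrite mulrA ler_pdivlMr ?mulr_gt0 // mulrC ler_pdivrMr ?mulr_gt0 ?exprn_gt0 //.
rewrite exprS; apply: le_trans (_ : x * x <= _).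
  by rewrite ler_wpM2l // ltW.
have -> : n.+1%:R * (x - y) * (x * x ^+ n * x) =
          (x * x) * (n.+1%:R * (x - y) * x ^+ n) by ring.
by rewrite ler_peMr // mulr_ge0 // ltW.
Qed.

Lemma sum_invr_nroot_tail (R : realType) (n A d : nat) :
  (0 < n)%N -> (0 < A)%N ->
  \sum_(A.+1 <= k < (A + d).+1) (k%:R * nroot R n k)^-1 <=
  n%:R * ((nroot R n A)^-1 - (nroot R n (A + d))^-1).
Proof.
case: n => // n _ A0; elim: d => [|d IH].
  by rewrite addn0 big_geq // subrr mulr0.
rewrite addnS big_nat_recr ?ltnS ?leq_addr //=.
apply: le_trans (lerD IH (invr_nroot_telescope R n _)) _.
  by rewrite addn_gt0 A0.
by rewrite -mulrDr subrKA.
Qed.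

Lemma sum_invr_nroot_gt (R : realType) (n A N : nat) :
  (0 < n)%N -> (0 < A)%N ->
  \sum_(A.+1 <= k < N.+1) (k%:R * nroot R n k)^-1 <= n%:R / nroot R n A.
Proof.
move=> n0 A0; have rA := nroot_gt0 R n A0.
have [AN|NA] := leqP A N; last first.
  by rewrite big_geq ?ltnS ?(ltnW NA) // divr_ge0 // nroot_ge0.
rewrite -(subnKC AN); apply: le_trans (sum_invr_nroot_tail _ _ n0 A0) _.
by rewrite ler_wpM2l // lerBlDr lerDl invr_ge0 nroot_ge0.
Qed.

Lemma sum_invr_nroot (R : realType) (n N : nat) : (0 < n)%N ->
  \sum_(1 <= k < N.+1) (k%:R * nroot R n k)^-1 <= n.+1%:R.
Proof.
move=> n0; case: N => [|N]; first by rewrite big_geq.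
rewrite big_ltn // /nroot powR1 mulr1 invr1 -nat1r lerD2l.
have := @sum_invr_nroot_gt R n 1 N.+1 n0 isT.
by rewrite /nroot powR1 divr1.
Qed.

Lemma sum_invr_sqr_gt (R : realType) (A N : nat) : (0 < A)%N ->
  \sum_(A.+1 <= k < N.+1) (k%:R ^- 2 : R) <= A%:R^-1.
Proof.
move=> A0; have := @sum_invr_nroot_gt R 1 A N isT A0.
rewrite {2}/nroot invr1 powRr1 // mul1r; apply: le_trans.
by apply: ler_sum => k _; rewrite /nroot invr1 powRr1 // expr2.
Qed.

Lemma sum_invr_sqr (R : realType) (N : nat) :
  \sum_(1 <= k < N.+1) (k%:R ^- 2 : R) <= 2.
Proof.
have := @sum_invr_nroot R 1 N isT; apply: le_trans.
by apply: ler_sum => k _; rewrite /nroot invr1 powRr1 // expr2.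
Qed.

(** * The sum of [moebius k / k ^ 2] *)

Lemma series_zeta2E (R : realType) (N : nat) :
  series (fun k : nat => (k.+1%:R : R) ^- 2) N = \sum_(1 <= k < N.+1) k%:R ^- 2.
Proof. by rewrite /series /= big_add1. Qed.

Lemma cvgn_zeta2 (R : realType) :
  cvgn (series (fun k : nat => (k.+1%:R : R) ^- 2)).
Proof.
apply: nondecreasing_is_cvgn.
  by apply: nondecreasing_series => k _ _; rewrite invr_ge0 exprn_ge0.
exists 2 => _ [N _ <-]; rewrite series_zeta2E; exact: sum_invr_sqr.
Qed.

Lemma zeta2_ge (R : realType) (N : nat) :
  \sum_(1 <= k < N.+1) (k%:R : R) ^- 2 <= zeta R 2.
Proof.
rewrite -series_zeta2E; apply: nondecreasing_cvgn_le (@cvgn_zeta2 R) _.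
by apply: nondecreasing_series => k _ _; rewrite invr_ge0 exprn_ge0.
Qed.

Lemma zeta2_ge1 (R : realType) : 1 <= zeta R 2.
Proof.
have := zeta2_ge R 1.
by rewrite big_ltn // big_geq // addr0 expr1n invr1.
Qed.

Lemma zeta2_le (R : realType) (A : nat) : (0 < A)%N ->
  zeta R 2 <= \sum_(1 <= k < A.+1) (k%:R : R) ^- 2 + A%:R^-1.
Proof.
move=> A0; apply: limr_le; first exact: cvgn_zeta2.
near=> N; rewrite series_zeta2E.
have AN : (A <= N)%N by near: N; exists A.
rewrite (@big_cat_nat _ _ _ A.+1) //= lerD2l; exact: sum_invr_sqr_gt.
Unshelve. all: by end_near. Qed.

(** Grouping the double sum by the product [k l] leaves, by [sum_moebius_dvd], only
the term with [k l = 1]. *)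
Lemma sum_moebius_divn (R : realType) (N : nat) : (0 < N)%N ->
  \sum_(1 <= k < N.+1) (moebius k)%:~R / k%:R ^+ 2 *
     (\sum_(1 <= l < (N %/ k).+1) (l%:R : R) ^- 2) = 1.
Proof.
move=> N0.
have inner k : (0 < k)%N -> k%:R ^- 2 * (\sum_(1 <= l < (N %/ k).+1) (l%:R : R) ^- 2)
   = \sum_(1 <= m < N.+1 | (k %| m)%N) (m%:R : R) ^- 2.
  move=> k0; rewrite mulr_sumr -[RHS]big_filter.
  rewrite [RHS](perm_big [seq (k * l)%N | l <- index_iota 1 (N %/ k).+1]) /=.
    by rewrite big_map; apply: eq_bigr => l _; rewrite natrM exprMn [RHS]invfM.
  apply: uniq_perm.
  - by rewrite filter_uniq // iota_uniq.
  - rewrite map_inj_uniq ?iota_uniq // => x y /eqP.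
    by rewrite eqn_pmul2l // => /eqP.
  move=> m; rewrite mem_filter mem_index_iota; apply/idP/mapP.
    move=> /andP[/dvdnP[l ->]]; rewrite ltnS => /andP[l0 lN].
    exists l; last by rewrite mulnC.
    rewrite mem_index_iota ltnS leq_divRL // lN andbT.
    by move: l0; rewrite muln_gt0 => /andP[].
  move=> [l]; rewrite mem_index_iota ltnS leq_divRL // => /andP[l0 lN] ->.
  by rewrite dvdn_mulr //= muln_gt0 k0 l0 ltnS mulnC.
transitivity (\sum_(1 <= m < N.+1) (m%:R : R) ^- 2 *
    \sum_(1 <= k < N.+1 | (k %| m)%N) (moebius k)%:~R).
  under [RHS]eq_bigr do rewrite mulr_sumr.
  under [RHS]eq_bigr do rewrite big_mkcond.
  rewrite exchange_big_nat /=; apply: eq_big_nat => k /andP[k0 _].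
  rewrite -mulrA inner // -big_mkcond mulr_sumr; apply: eq_bigr => m _.
  by rewrite mulrC.
transitivity (\sum_(1 <= m < N.+1) (m%:R : R) ^- 2 * (m == 1%N)%:R).
  apply: eq_big_nat => m mN.
  rewrite -(rmorph_sum (@intmul R 1)) /= sum_moebius_dvd //.
  by rewrite natz pmulrn.
rewrite big_ltn // expr1n invr1 mulr1 big_nat big1 ?addr0 // => m /andP[m1 mN].
by rewrite gtn_eqF // mulr0.
Qed.

(** In [sum_moebius_divn] the inner sum is within [1 / (N %/ k)] of [zeta 2]. Weakening
that bound to [2 (k / N) ^ (1 / 2)] makes the errors summable over [k], with a
factor [N ^ (- 1 / 2)] to spare. *)
Lemma sum_moebius_zeta2 (R : realType) (N : nat) : (0 < N)%N ->
  `|\sum_(1 <= k < N.+1) (moebius k)%:~R / k%:R ^+ 2 - (zeta R 2)^-1| <=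
  6 / nroot R 2 N.
Proof.
move=> N0; set S := \sum_(1 <= k < N.+1) _.
have z1 := zeta2_ge1 R; have z0 : 0 < zeta R 2 by apply: lt_le_trans z1.
have rN := nroot_gt0 R 2 N0.
have -> : S - (zeta R 2)^-1 = (zeta R 2 * S - 1) / zeta R 2.
  by field; rewrite gt_eqF.
rewrite normrM normfV (gtr0_norm z0).
apply: le_trans (_ : `|zeta R 2 * S - 1| <= _).
  by rewrite ler_pdivrMr // ler_peMr.
rewrite -[1 in X in X <= _](@sum_moebius_divn R N N0) mulr_sumr -sumrB.
apply: le_trans (ler_norm_sum _ _ _) _.
have -> : 6 / nroot R 2 N = 2 / nroot R 2 N * 3 by ring.
apply: le_trans (_ : 2 / nroot R 2 N *
    (\sum_(1 <= k < N.+1) (k%:R * nroot R 2 k)^-1) <= _); last first.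
  by rewrite ler_wpM2l ?divr_ge0 ?(ltW rN) // sum_invr_nroot.
rewrite mulr_sumr big_nat [leRHS]big_nat; apply: ler_sum => k /andP[k0 kN].
have kR : 0 < k%:R :> R by rewrite ltr0n.
have rk := nroot_gt0 R 2 k0.
rewrite [zeta R 2 * _]mulrC -mulrBr normrM.
have dN : (0 < N %/ k)%N by rewrite divn_gt0.
have H1 : `|zeta R 2 - \sum_(1 <= l < (N %/ k).+1) (l%:R : R) ^- 2| <=
    (N %/ k)%:R^-1.
  rewrite ger0_norm ?subr_ge0 ?zeta2_ge // lerBlDl; exact: zeta2_le.
have H2 : `|(moebius k)%:~R / k%:R ^+ 2 : R| <= k%:R ^- 2.
  rewrite normrM normfV (ger0_norm (exprn_ge0 2 (ltW kR))).
  rewrite ler_piMl ?invr_ge0 ?exprn_ge0 // -intr_norm.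
  by rewrite -[1]/(1%:~R) ler_int normr_moebius.
apply: le_trans (ler_pM _ _ H2 H1) _ => //.
have H3 : (N %/ k)%:R^-1 <= 2 * nroot R 2 k / nroot R 2 N :> R.
  apply: le_trans (_ : 2 * k%:R / N%:R <= _).
    rewrite -[leLHS]mul1r ler_pdivrMr ?ltr0n // mulrAC ler_pdivlMr ?ltr0n //.
    rewrite mul1r -!natrM ler_nat.
    have := ltn_ceil N k0; have := leq_pmulr k dN.
    by rewrite mulSn [(_ %/ _ * _)%N]mulnC -mulnA; lia.
  rewrite -(@nrootX R 2 k) // -(@nrootX R 2 N) //.
  have -> : 2 * nroot R 2 k ^+ 2 / nroot R 2 N ^+ 2 =
     2 * nroot R 2 k / nroot R 2 N * (nroot R 2 k / nroot R 2 N).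
    by field; rewrite gt_eqF.
  rewrite ler_piMr ?divr_ge0 ?mulr_ge0 ?nroot_ge0 //.
  by rewrite ler_pdivrMr // mul1r ler_nroot.
apply: le_trans (ler_wpM2l _ H3) _; first by rewrite invr_ge0 exprn_ge0.
have e : nroot R 2 k = k%:R / nroot R 2 k.
  by rewrite -(@nrootX R 2 k) // expr2 mulfK // gt_eqF.
rewrite [in leLHS]e le_eqVlt; apply/orP; left.
by apply/eqP; field; rewrite !gt_eqF.
Qed.

(** * Integral boxes *)

Definition ibox (m : nat) : seq int := [seq i%:Z - m%:Z | i <- iota 0 m.*2.+1].

Arguments ibox : simpl never.

Lemma mem_ibox (m : nat) (x : int) : (x \in ibox m) = (`|x| <= m)%N.
Proof.
apply/mapP/idP => [[i]|xm].
  by rewrite mem_iota => im ->; lia.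
exists (absz (x + m%:Z)); last by lia.
by rewrite mem_iota; lia.
Qed.

Lemma ibox_uniq (m : nat) : uniq (ibox m).
Proof. by rewrite map_inj_uniq ?iota_uniq // => i j; lia. Qed.

Definition box3 (m : nat) : seq (int * int * int) :=
  [seq (p, z) | p <- [seq (a, c) | a <- ibox m, c <- ibox m], z <- ibox m].

Lemma mem_box3 (m : nat) (t : int * int * int) :
  (t \in box3 m) =
  [&& (`|t.1.1| <= m)%N, (`|t.1.2| <= m)%N & (`|t.2| <= m)%N].
Proof.
case: t => -[a c] z /=; apply/allpairsP/idP.
  move=> [[p z'] [/allpairsP[[a' c'] [am cm ->]] zm]].
  by move: am cm zm => /=; rewrite !mem_ibox => am cm zm [-> -> ->]; apply/and3P.
move=> /and3P[am cm zm]; exists ((a, c), z); split; rewrite ?mem_ibox //.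
by apply/allpairsP; exists (a, c); rewrite !mem_ibox.
Qed.

Lemma box3_uniq (m : nat) : uniq (box3 m).
Proof.
apply: allpairs_uniq; rewrite ?ibox_uniq //.
  by apply: allpairs_uniq; rewrite ?ibox_uniq // => -[? ?] [? ?] _ _ [-> ->].
by move=> [[? ?] ?] [[? ?] ?] _ _ [-> -> ->].
Qed.

Lemma big_box3 (V : nmodType) (m : nat) (F : int * int * int -> V) :
  \sum_(t <- box3 m) F t =
  \sum_(a <- ibox m) \sum_(c <- ibox m) \sum_(z <- ibox m) F (a, c, z).
Proof. by rewrite !big_allpairs. Qed.

Lemma sum_ibox_le (R : realType) (m : nat) (f : nat -> R) :
  (forall i, 0 <= f i) ->
  \sum_(x <- ibox m) f `|x|%N <= 2 * \sum_(0 <= i < m.+1) f i.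
Proof.
move=> f0; rewrite big_map.
have -> : iota 0 m.*2.+1 = iota 0 m ++ iota m m.+1.
  by rewrite -iotaD; congr iota; lia.
rewrite big_cat /= mulr_natl mulr2n lerD //.
  apply: le_trans (_ : \sum_(1 <= i < m.+1) f i <= _); last first.
    by rewrite [leRHS]big_ltn // lerDr.
  rewrite -[m in iota 0 m]subn0 -/(index_iota 0 m) big_add1 /=.
  rewrite big_nat_rev /= add0n le_eqVlt; apply/orP; left; apply/eqP.
  by apply: eq_big_nat => i /andP[_ im]; congr f; lia.
have -> : m :: iota m.+1 m = [seq (m + i)%N | i <- iota 0 m.+1].
  by rewrite -iotaDl addn0.
rewrite big_map le_eqVlt; apply/orP; left; apply/eqP.
by rewrite /index_iota subn0; apply: eq_bigr => i _; congr f; lia.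
Qed.

Lemma sum_box3_le (R : realType) (m : nat) (f : nat -> nat -> nat -> R) :
  (forall i j k, 0 <= f i j k) ->
  \sum_(t <- box3 m) f `|t.1.1|%N `|t.1.2|%N `|t.2|%N <=
  8 * \sum_(0 <= i < m.+1) \sum_(0 <= j < m.+1) \sum_(0 <= k < m.+1) f i j k.
Proof.
move=> f0; rewrite big_box3 /=.
have -> : 8 = 2 * (2 * 2) :> R by ring.
rewrite -!mulrA.
apply: le_trans (_ : \sum_(a <- ibox m) (2 * (2 * \sum_(0 <= j < m.+1)
    \sum_(0 <= k < m.+1) f `|a|%N j k)) <= _).
  apply: ler_sum => a _.
  apply: le_trans (_ : \sum_(c <- ibox m) (2 *
    \sum_(0 <= k < m.+1) f `|a|%N `|c|%N k) <= _).
    by apply: ler_sum => c _; apply: sum_ibox_le.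
  apply: le_trans (sum_ibox_le m (f := fun j => 2 *
    \sum_(0 <= k < m.+1) f `|a|%N j k) _) _; last by rewrite -!mulr_sumr.
  by move=> i; rewrite mulr_ge0 // sumr_ge0.
apply: le_trans (sum_ibox_le m (f := fun i => 2 * (2 * \sum_(0 <= j < m.+1)
    \sum_(0 <= k < m.+1) f i j k)) _) _; last by rewrite -!mulr_sumr.
by move=> i; rewrite !mulr_ge0 // sumr_ge0 // => j _; rewrite sumr_ge0.
Qed.

(** The quantity called [M] in the comments. *)
Definition maxc (t : int * int * int) : nat :=
  maxn (maxn `|t.1.1| `|t.1.2|) `|t.2|.

(** * Sums over integral points by size *)

Lemma sum_leq_indicator (R : realType) (m i : nat) :
  \sum_(0 <= j < m) ((j <= i)%N%:R : R) <= i.+1%:R.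
Proof.
rewrite -natr_sum ler_nat; elim: m => [|m IH]; first by rewrite big_geq.
have [mi|im] := leqP m.+1 i.+1.
  apply: leq_trans (_ : \sum_(0 <= j < m.+1) 1 <= _)%N.
    by apply: leq_sum => j _; apply: leq_b1.
  by rewrite sum_nat_const_nat subn0 muln1.
by move: im; rewrite ltnS => im; rewrite big_nat_recr //= [(m <= i)%N]leqNgt im addn0.
Qed.

(** Among three indices, one of the largest dominates the other two. *)
Lemma sum_shell_le (R : realType) (m : nat) (f : nat -> R) :
  (forall i, 0 <= f i) ->
  \sum_(0 <= i < m.+1) \sum_(0 <= j < m.+1) \sum_(0 <= k < m.+1)
     f (maxn (maxn i j) k) <= 3 * \sum_(0 <= i < m.+1) f i * i.+1%:R ^+ 2.
Proof.
move=> f0.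
pose G i j k : R := f i * ((j <= i)%N%:R * (k <= i)%N%:R).
have G0 i j k : 0 <= G i j k by rewrite /G !mulr_ge0.
have GG i j k : f (maxn (maxn i j) k) <= G i j k + (G j i k + G k i j).
  have [m1 | [m2 | m3]] : (maxn (maxn i j) k = i /\ (j <= i)%N /\ (k <= i)%N) \/
      (maxn (maxn i j) k = j /\ (i <= j)%N /\ (k <= j)%N) \/
      (maxn (maxn i j) k = k /\ (i <= k)%N /\ (j <= k)%N) by lia.
  - case: m1 => -> [ji ki]; apply: le_trans (_ : G i j k <= _).
      by rewrite /G ji ki !mulr1.
    by rewrite lerDl addr_ge0.
  - case: m2 => -> [ji ki]; apply: le_trans (_ : G j i k <= _).
      by rewrite /G ji ki !mulr1.
    by rewrite addrCA lerDl addr_ge0.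
  - case: m3 => -> [ji ki]; apply: le_trans (_ : G k i j <= _).
      by rewrite /G ji ki !mulr1.
    by rewrite addrA lerDr addr_ge0.
have SG : \sum_(0 <= i < m.+1) \sum_(0 <= j < m.+1) \sum_(0 <= k < m.+1)
   G i j k <= \sum_(0 <= i < m.+1) f i * i.+1%:R ^+ 2.
  apply: ler_sum => i _.
  under eq_bigr do rewrite -mulr_sumr -mulr_sumr.
  rewrite -mulr_sumr -mulr_suml expr2.
  by rewrite ler_wpM2l // ler_pM ?sumr_ge0 // sum_leq_indicator.
apply: le_trans (_ : \sum_(0 <= i < m.+1) \sum_(0 <= j < m.+1)
   \sum_(0 <= k < m.+1) (G i j k + (G j i k + G k i j)) <= _).
  by apply: ler_sum => i _; apply: ler_sum => j _; apply: ler_sum => k _.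
under eq_bigr do under eq_bigr do rewrite !big_split /=.
under eq_bigr do rewrite !big_split /=.
rewrite !big_split /= [X in _ + (X + _)]exchange_big /=.
under [X in _ + (_ + X)]eq_bigr do rewrite exchange_big /=.
rewrite [X in _ + (_ + X)]exchange_big /=.
have -> : 3 = 1 + (1 + 1) :> R by ring.
by rewrite !mulrDl !mul1r !lerD.
Qed.

(** The factor [96] is [2 ^ 3] for the signs, [3] for the position of the largest
coordinate and [4] for [(i + 1) ^ 2 <= 4 i ^ 2]. *)
Lemma sum_box3_maxc_le (R : realType) (m : nat) (f : nat -> R) :
  (forall i, 0 <= f i) -> f 0%N = 0 ->
  \sum_(t <- box3 m) f (maxc t) <= 96 * \sum_(1 <= i < m.+1) f i * i%:R ^+ 2.
Proof.
move=> f0 f00.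
apply: le_trans (sum_box3_le m (f := fun i j k => f (maxn (maxn i j) k)) _) _.
  by move=> *; exact: f0.
apply: le_trans (ler_wpM2l _ (sum_shell_le m f0)) _ => //.
rewrite big_ltn // f00 mul0r add0r.
have -> : 96 = 8 * 3 * 4 :> R by ring.
rewrite mulrA -[leRHS]mulrA; apply: ler_wpM2l => //; rewrite mulr_sumr.
rewrite big_nat [leRHS]big_nat ler_sum // => i /andP[i0 _].
rewrite [leRHS]mulrCA ler_wpM2l // [4](_ : _ = 2 ^+ 2) -?exprMn; last by ring.
by rewrite lerXn2r ?nnegrE // -natrM ler_nat; lia.
Qed.

Lemma sum_invr_sqr_above (R : realType) (m : nat) (Y : R) : 0 < Y ->
  \sum_(1 <= i < m.+1) (if Y < i%:R then i%:R ^- 2 else 0) <= 2 / Y.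
Proof.
move=> Y0; have /andP[yY Yy] := truncn_itv (ltW Y0); set y := Num.truncn Y in yY Yy *.
have [y0|y0] := posnP y.
  apply: le_trans (_ : 2 <= _).
    apply: le_trans (sum_invr_sqr R m); apply: ler_sum => i _.
    by case: ifP => // _; rewrite invr_ge0 exprn_ge0.
  by rewrite ler_pdivlMr // ler_piMr // ltW // -[1]/(1%:R) -[in 1%:R]y0.
have -> : \sum_(1 <= i < m.+1) (if Y < i%:R then i%:R ^- 2 else 0) =
    \sum_(y.+1 <= i < m.+1) (i%:R ^- 2 : R).
  rewrite [RHS](big_nat_widenl _ 1) // [RHS]big_mkcond /=; apply: eq_bigr => i _.
  by rewrite -truncn_lt_nat // ltW.
apply: le_trans (sum_invr_sqr_gt R m y0) _.
rewrite ler_pdivlMr // mulrC ler_pdivrMr ?ltr0n //.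
by apply: le_trans (ltW Yy) _; rewrite -natrM ler_nat; lia.
Qed.

(** The points with [M > Y]: since [n >= 3], their terms [M ^ (1 - n)] are at most
[Y ^ (3 - n) M ^ (- 2)]. *)
Lemma sum_far_le (R : realType) (n m : nat) (Y : R) : (3 <= n)%N -> 0 < Y ->
  \sum_(1 <= i < m.+1) (if Y < i%:R then 4 * Y ^+ (2 * n) / i%:R ^+ n.+1 else 0)
     * i%:R ^+ 2 <= 8 * Y ^+ n.+2.
Proof.
move=> n3 Y0.
apply: le_trans (_ : 4 * Y ^+ n.+3 * (2 / Y) <= _); last first.
  rewrite le_eqVlt; apply/orP; left; apply/eqP; rewrite [Y ^+ n.+3]exprS.
  by field; rewrite gt_eqF.
apply: le_trans (ler_wpM2l _ (sum_invr_sqr_above m Y0)); last first.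
  by rewrite mulr_ge0 // exprn_ge0 // ltW.
rewrite mulr_sumr big_nat [leRHS]big_nat; apply: ler_sum => i /andP[i0 _].
case: ifP => Yi; last by rewrite mul0r mulr0.
have iR : 0 < i%:R :> R by rewrite ltr0n.
set I := i%:R ^+ (n - 3) : R; set Q := Y ^+ (n - 3).
have -> : Y ^+ (2 * n) = Y ^+ n.+3 * Q by rewrite -exprD; congr (_ ^+ _); lia.
have -> : i%:R ^+ n.+1 = i%:R ^+ 2 * i%:R ^+ 2 * I.
  by rewrite -!exprD; congr (_ ^+ _); lia.
have I0 : 0 < I by rewrite exprn_gt0.
have QI : Q / I <= 1.
  by rewrite ler_pdivrMr // mul1r lerXn2r ?nnegrE // ltW.
have -> : 4 * (Y ^+ n.+3 * Q) / (i%:R ^+ 2 * i%:R ^+ 2 * I) * i%:R ^+ 2 =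
          4 * Y ^+ n.+3 / i%:R ^+ 2 * (Q / I).
  by field; rewrite !gt_eqF.
by rewrite ler_piMr // divr_ge0 ?exprn_ge0 // mulr_ge0 // exprn_ge0 // ltW.
Qed.

(** The rounding errors in the slices: [M ^ (2 - n) <= 1], and [M <= Y] takes at most
[Y] values. *)
Lemma sum_slice_le (R : realType) (n m : nat) (Y : R) : (2 <= n)%N -> 0 < Y ->
  \sum_(1 <= i < m.+1) (if (0 < i)%N && (i%:R <= Y) then Y ^+ n / i%:R ^+ n else 0)
     * i%:R ^+ 2 <= Y ^+ n.+2.
Proof.
move=> n2 Y0; have Y1 := ltW Y0.
have /andP[yY _] := truncn_itv Y1; set y := Num.truncn Y in yY *.
apply: le_trans (_ : Y ^+ n * \sum_(1 <= i < m.+1) (i <= y)%N%:R <= _).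
  rewrite mulr_sumr big_nat [leRHS]big_nat; apply: ler_sum => i /andP[i0 _].
  rewrite i0 /= truncn_ge_nat //; case: ifP => iY; last by rewrite mul0r mulr0.
  rewrite mulr1 -mulrA ler_piMr ?exprn_ge0 // mulrC.
  have iR : 0 < i%:R :> R by rewrite ltr0n.
  rewrite ler_pdivrMr ?exprn_gt0 // mul1r ler_weXn2l //.
  by rewrite ler1n.
rewrite -addn2 exprD ler_wpM2l ?exprn_ge0 //.
apply: le_trans (_ : y%:R <= _).
  have := sum_leq_indicator R m.+1 y.
  by rewrite big_ltn // leq0n -nat1r lerD2l.
apply: le_trans (_ : y%:R ^+ 2 <= _).
  by rewrite -natrX ler_nat; case: (y) => // y'; rewrite -mulnn leq_pmulr.
by rewrite lerXn2r ?nnegrE // ltW.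
Qed.

(** Interpolation between two competing bounds, with weights [n / (n + 1)] and
[1 / (n + 1)]. *)
Lemma min_le_geometric_mean (R : realType) (n : nat) (x w Z : R) :
  0 <= x -> 0 <= w -> 0 <= Z -> Z ^+ n.+1 = x ^+ n * w -> Num.min x w <= Z.
Proof.
move=> x0 w0 Z0 e; set u := Num.min x w.
have u0 : 0 <= u by rewrite le_min x0.
rewrite -(@ler_pXn2r _ n.+1) ?nnegrE // e exprSr.
apply: ler_pM => //; first exact: exprn_ge0; last by rewrite ge_min lexx orbT.
by rewrite lerXn2r ?nnegrE // ge_min lexx.
Qed.

Lemma sum_dvdn_leq (m d y : nat) : (0 < d)%N ->
  (\sum_(1 <= i < m.+1) ((d %| i) && (i <= y)) = minn m y %/ d)%N.
Proof.
move=> d0; elim: m => [|m IH]; first by rewrite big_geq // min0n div0n.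
rewrite big_nat_recr //= IH; have [my|ym] : (m.+1 <= y)%N \/ (y < m.+1)%N by lia.
  have -> : minn m y = m by lia.
  have -> : minn m.+1 y = m.+1 by lia.
  by rewrite divnS // my andbT addnC.
by rewrite leqNgt ym andbF addn0; congr (_ %/ _)%N; lia.
Qed.

(** Each divisor of [gcdn i j] is bounded by the sum over all common divisors;
the multiples of [d] up to [i] number at most [2 i / d]. *)
Lemma sum_gcdn_le (R : realType) (n m i : nat) : (0 < i <= m)%N ->
  \sum_(0 <= j < m.+1) (j <= i)%N%:R * ((gcdn i j)%:R / nroot R n (gcdn i j)) <=
  2 * i%:R * \sum_(1 <= d < m.+1) (d %| i)%N%:R / nroot R n d.
Proof.
move=> /andP[i0 im].
apply: le_trans (_ : \sum_(0 <= j < m.+1) \sum_(1 <= d < m.+1)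
   (d %| i)%N%:R * (d%:R / nroot R n d) * ((d %| j) && (j <= i))%N%:R <= _).
  apply: ler_sum => j _.
  have g0 : (0 < gcdn i j)%N by rewrite gcdn_gt0 i0.
  have gm : (gcdn i j < m.+1)%N.
    by rewrite ltnS; apply: leq_trans im; rewrite dvdn_leq ?dvdn_gcdl.
  rewrite (@big_cat_nat _ _ _ (gcdn i j)) ?(ltnW gm) //= [X in _ + X]big_ltn //.
rewrite dvdn_gcdl dvdn_gcdr mul1r /= [leLHS]mulrC addrCA lerDl addr_ge0 //;
  by apply: sumr_ge0 => d _; rewrite !mulr_ge0 // ?invr_ge0 nroot_ge0.
rewrite exchange_big /= mulr_sumr big_nat [leRHS]big_nat.
apply: ler_sum => d /andP[d0 _]; rewrite -mulr_sumr.
have [di|] := boolP (d %| i)%N; last by rewrite !mul0r mulr0.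
rewrite !mul1r mulrAC [leRHS]mulrC [leRHS]mulrC ler_wpM2r ?invr_ge0 ?nroot_ge0 //.
rewrite -natr_sum -!natrM ler_nat big_ltn // dvdn0 /= sum_dvdn_leq //.
have -> : minn m i = i by lia.
rewrite mulnDr mulnC [(d * (_ %/ _))%N]mulnC divnK // mul1n.
have := dvdn_leq i0 di; lia.
Qed.

Lemma sum_gcdn_ratio_le (R : realType) (n m : nat) (Y : R) : (0 < n)%N -> 0 < Y ->
  \sum_(0 <= i < m.+1) \sum_(0 <= j < m.+1)
    (if (0 < maxn i j)%N && ((maxn i j)%:R <= Y) then
       (gcdn i j)%:R / nroot R n (gcdn i j) / (maxn i j)%:R else 0) <=
  4 * n.+1%:R * Y.
Proof.
move=> n0 Y0; have Y1 := ltW Y0.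
pose G i j : R := (gcdn i j)%:R / nroot R n (gcdn i j).
have G0 i j : 0 <= G i j by rewrite /G divr_ge0 // nroot_ge0.
pose h i j : R := if (0 < i)%N && (i%:R <= Y)
  then (j <= i)%N%:R * G i j / i%:R else 0.
have h0 i j : 0 <= h i j.
  by rewrite /h; case: ifP => // _; rewrite divr_ge0 // mulr_ge0.
have half : \sum_(0 <= i < m.+1) \sum_(0 <= j < m.+1) h i j <= 2 * n.+1%:R * Y.
  rewrite big_ltn // [X in X + _]big1 ?add0r; last by move=> j _; rewrite /h ltnn.
  apply: le_trans (_ : \sum_(1 <= i < m.+1) 2 *
     \sum_(1 <= d < m.+1) ((d %| i) && (i <= Num.truncn Y))%N%:R / nroot R n d <= _).
    rewrite big_nat [leRHS]big_nat; apply: ler_sum => i /andP[i0 im].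
    rewrite /h i0 /= truncn_ge_nat //; case: (boolP (i%:R <= Y)) => iY; last first.
      rewrite big1 // mulr_ge0 // sumr_ge0 // => d _.
      by rewrite divr_ge0 ?nroot_ge0.
    rewrite -mulr_suml ler_pdivrMr ?ltr0n //.
    under [X in _ <= _ * X * _]eq_bigr do rewrite andbT.
    by rewrite mulrAC sum_gcdn_le // i0.
  rewrite -mulr_sumr -[leRHS]mulrA ler_wpM2l // exchange_big /=.
  apply: le_trans (_ : \sum_(1 <= d < m.+1) Y * (d%:R * nroot R n d)^-1 <= _).
    rewrite big_nat [leRHS]big_nat; apply: ler_sum => d /andP[d0 _].
    rewrite -mulr_suml invfM mulrA ler_wpM2r ?invr_ge0 ?nroot_ge0 //.
    rewrite -natr_sum sum_dvdn_leq // ler_pdivlMr ?ltr0n // -natrM.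
    apply: le_trans (_ : (Num.truncn Y)%:R <= _).
      by rewrite ler_nat; apply: leq_trans (leq_trunc_div _ _) _; rewrite geq_minr.
    by rewrite truncn_le ltW.
  by rewrite -mulr_sumr mulrC ler_wpM2r // sum_invr_nroot.
apply: le_trans (_ : \sum_(0 <= i < m.+1) \sum_(0 <= j < m.+1) (h i j + h j i) <= _).
  apply: ler_sum => i _; apply: ler_sum => j _; rewrite -/(G i j).
  have [ji|ij] : (j <= i)%N \/ (i < j)%N by lia.
    have -> : maxn i j = i by lia.
    by rewrite {1}/h ji mul1r lerDl.
  have -> : maxn i j = j by lia.
  by rewrite {2}/h (ltnW ij) mul1r /G gcdnC lerDr.
under eq_bigr do rewrite big_split /=.
rewrite big_split /= [X in _ + X]exchange_big /=.
have -> : 4 * n.+1%:R * Y = 2 * n.+1%:R * Y + 2 * n.+1%:R * Y by ring.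
by rewrite lerD.
Qed.

Lemma sum_maxn_nroot_le (R : realType) (n m A : nat) : (0 < n)%N -> (0 < A)%N ->
  \sum_(0 <= k < m.+1) ((maxn A k)%:R * nroot R n (maxn A k))^-1 <=
  n.+2%:R / nroot R n A.
Proof.
move=> n0 A0; have rA := nroot_gt0 R n A0; have rA' := ltW rA.
have AR : 0 < A%:R :> R by rewrite ltr0n.
apply: le_trans (_ : \sum_(0 <= k < m.+1) ((k <= A)%N%:R * (A%:R * nroot R n A)^-1 +
   (if (A < k)%N then (k%:R * nroot R n k)^-1 else 0)) <= _).
  apply: ler_sum => k _; have [kA|Ak] : (k <= A)%N \/ (A < k)%N by lia.
    have -> : maxn A k = A by lia.
    by rewrite kA ltnNge kA mul1r addr0.
  have -> : maxn A k = k by lia.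
  by rewrite Ak leqNgt Ak mul0r add0r.
rewrite big_split /= -mulr_suml -[n.+2]add2n natrD mulrDl lerD //.
  apply: le_trans (ler_wpM2r _ (sum_leq_indicator R m.+1 A)) _.
    by rewrite invr_ge0 mulr_ge0.
  rewrite invfM mulrA ler_wpM2r ?invr_ge0 ?(ltW rA) // ler_pdivrMr //.
  by rewrite -natrM ler_nat; lia.
apply: le_trans (sum_invr_nroot_gt R m n0 A0).
by rewrite -big_mkcond [in leRHS](big_nat_widenl _ 0).
Qed.

(** The error bound of one fibre: rounding in at most [Y ^ n / M ^ n] slices, and
the distance from a Riemann sum to its integral, which is at most one term
of the sum and at most the integral itself. Above the height bound only the
integral is left. *)
Definition fibre_error (R : realType) (n : nat) (Y : R) (i j k : nat) : R :=
  let A := maxn i j in let M := maxn A k in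
  if (0 < A)%N then
    if M%:R <= Y then
      Y ^+ n / M%:R ^+ n +
      Num.min (2 * Y ^+ n * (gcdn i j)%:R / A%:R)
              (4 * Y ^+ (2 * n) / M%:R ^+ n.+1)
    else 4 * Y ^+ (2 * n) / M%:R ^+ n.+1
  else 0.

(** With [g = gcdn i j], the two bounds are, up to a factor [4 Y ^ n], [g / A] and
[Y ^ n / M ^ (n + 1)]. The first one alone is too large by a logarithm when summed
over [M <= Y], the second one is too large for small [M]; their geometric mean with
weights [1 - 1 / n] and [1 / n] has only [Y] to the first power and a summable
dependence on [g]. *)
Lemma riemann_error_le (R : realType) (n : nat) (Y : R) (i j k : nat) :
  (0 < n)%N -> 0 < Y -> (0 < maxn i j)%N ->
  Num.min (2 * Y ^+ n * (gcdn i j)%:R / (maxn i j)%:R)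
     (4 * Y ^+ (2 * n) / (maxn (maxn i j) k)%:R ^+ n.+1) <=
  4 * Y ^+ n.+1 * ((gcdn i j)%:R / nroot R n (gcdn i j) / (maxn i j)%:R *
    (nroot R n (maxn i j) *
     ((maxn (maxn i j) k)%:R * nroot R n (maxn (maxn i j) k))^-1)).
Proof.
move=> n0 Y0; set A := maxn i j; set M := maxn A k; set g := gcdn i j => A0.
have M0 : (0 < M)%N by rewrite /M; lia.
have g0 : (0 < g)%N by rewrite /g gcdn_gt0; move: A0; rewrite /A; lia.
have gA : (g %| A)%N.
  by rewrite /g /A /maxn; case: ifP => _; rewrite ?dvdn_gcdr ?dvdn_gcdl.
have AR : 0 < A%:R :> R by rewrite ltr0n.
have MR : 0 < M%:R :> R by rewrite ltr0n.
have gR : 0 < g%:R :> R by rewrite ltr0n.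
have rA := nroot_gt0 R n A0; have rM := nroot_gt0 R n M0.
have rg := nroot_gt0 R n g0.
have Yn : 0 < Y ^+ n by rewrite exprn_gt0.
pose x : R := g%:R / A%:R; pose w : R := Y ^+ n / M%:R ^+ n.+1.
have x0 : 0 < x by rewrite divr_gt0.
have w0 : 0 < w by rewrite divr_gt0 // exprn_gt0.
have [xdef wdef] : x = g%:R / A%:R /\ w = Y ^+ n / M%:R ^+ n.+1 by [].
clearbody x w.
pose Z := x * (nroot R n A / nroot R n g) * (Y / (M%:R * nroot R n M)).
have Z0 : 0 <= Z by rewrite !mulr_ge0 ?invr_ge0 ?mulr_ge0 // ltW.
have ZE : Z ^+ n = x ^+ n.-1 * w.
  have xE : x ^+ n = x ^+ n.-1 * x by rewrite -exprSr prednK.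
  have -> : Z ^+ n = x ^+ n * (nroot R n A ^+ n / nroot R n g ^+ n) *
      (Y ^+ n / (M%:R ^+ n * nroot R n M ^+ n)).
    by rewrite -exprMn -!expr_div_n -!exprMn.
  rewrite xE !nrootX // -mulrA -mulrA; congr (_ * _).
  by rewrite wdef exprSr xdef; field; rewrite !gt_eqF // exprn_gt0.
have mZ : Num.min x w <= Z.
  by apply: (@min_le_geometric_mean R n.-1); rewrite ?prednK // ltW.
apply: le_trans (_ : 4 * Y ^+ n * Num.min x w <= _); last first.
  apply: le_trans (_ : 4 * Y ^+ n * Z <= _).
    by rewrite ler_wpM2l // mulr_ge0 // ltW.
  rewrite le_eqVlt; apply/orP; left; apply/eqP; rewrite /Z xdef exprS.
  by field; rewrite !gt_eqF.
have -> : 2 * Y ^+ n * g%:R / A%:R = 2 * Y ^+ n * x by rewrite xdef mulrA.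
have -> : 4 * Y ^+ (2 * n) / M%:R ^+ n.+1 = 4 * Y ^+ n * w.
  by rewrite wdef mul2n -addnn exprD !mulrA.
have [xw|wx] := leP x w; rewrite ge_min; apply/orP; [left|by right].
by rewrite ler_pM2r // ler_pM2r // ler_nat.
Qed.

(** The sum over [k] yields [nroot A ^ (- 1)] by [sum_maxn_nroot_le], which cancels the
factor [nroot A]; what is left is bounded in [sum_gcdn_ratio_le]. *)
Lemma riemann_error_sum_le (R : realType) (n m : nat) (Y : R) :
  (0 < n)%N -> 0 < Y ->
  \sum_(0 <= i < m.+1) \sum_(0 <= j < m.+1) \sum_(0 <= k < m.+1)
   (if (0 < maxn i j)%N && ((maxn (maxn i j) k)%:R <= Y) then
     Num.min (2 * Y ^+ n * (gcdn i j)%:R / (maxn i j)%:R)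
       (4 * Y ^+ (2 * n) / (maxn (maxn i j) k)%:R ^+ n.+1) else 0) <=
  16 * n.+1%:R * n.+2%:R * Y ^+ n.+2.
Proof.
move=> n0 Y0; have Y1 := ltW Y0.
have -> : 16 * n.+1%:R * n.+2%:R * Y ^+ n.+2 =
   4 * Y ^+ n.+1 * n.+2%:R * (4 * n.+1%:R * Y) by rewrite [Y ^+ n.+2]exprS; ring.
apply: le_trans (ler_wpM2l _ (sum_gcdn_ratio_le m n0 Y0)); last first.
  by rewrite !mulr_ge0 // exprn_ge0.
rewrite mulr_sumr; apply: ler_sum => i _; rewrite mulr_sumr.
apply: ler_sum => j _; case: ifPn => [/andP[A0 AY]|AY]; last first.
  rewrite big1 ?mulr0 // => k _; rewrite ifF //; apply: contraNF AY.
  case/andP=> -> /= H; apply: le_trans H.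
  by rewrite ler_nat leq_maxl.
set rho := _ / _ / _; set r := nroot R n (maxn i j).
have r0 : 0 < r by rewrite nroot_gt0.
have rho0 : 0 <= rho by rewrite !divr_ge0 // nroot_ge0.
apply: le_trans (_ : \sum_(0 <= k < m.+1) 4 * Y ^+ n.+1 * (rho * (r *
     ((maxn (maxn i j) k)%:R * nroot R n (maxn (maxn i j) k))^-1)) <= _).
  apply: ler_sum => k _; case: ifPn => _; first exact: riemann_error_le.
  by rewrite !mulr_ge0 ?invr_ge0 ?mulr_ge0 ?exprn_ge0 ?(ltW r0) // nroot_ge0.
rewrite -!mulr_sumr -[leRHS]mulrA ler_wpM2l ?mulr_ge0 ?exprn_ge0 //.
rewrite mulrC ler_wpM2r //.
apply: le_trans (ler_wpM2l (ltW r0) (sum_maxn_nroot_le R m n0 A0)) _.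
by rewrite mulrC divfK // gt_eqF.
Qed.

(** Here [864 = 96 * (8 + 1)] comes from [sum_far_le] and [sum_slice_le], and
[128 = 8 * 16] from [riemann_error_sum_le]. *)
Lemma fibre_error_sum_le (R : realType) (n m : nat) (Y : R) : (3 <= n)%N -> 0 < Y ->
  \sum_(t <- box3 m) fibre_error n Y `|t.1.1|%N `|t.1.2|%N `|t.2|%N <=
  (864 + 128 * n.+1%:R * n.+2%:R) * Y ^+ n.+2.
Proof.
move=> n3 Y0; have Y1 := ltW Y0; have n0 : (0 < n)%N by lia.
pose far i : R := if Y < i%:R then 4 * Y ^+ (2 * n) / i%:R ^+ n.+1 else 0.
pose slc i : R := if (0 < i)%N && (i%:R <= Y) then Y ^+ n / i%:R ^+ n else 0.
pose mid i j k : R := if (0 < maxn i j)%N && ((maxn (maxn i j) k)%:R <= Y) then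
     Num.min (2 * Y ^+ n * (gcdn i j)%:R / (maxn i j)%:R)
       (4 * Y ^+ (2 * n) / (maxn (maxn i j) k)%:R ^+ n.+1) else 0.
have far0 i : 0 <= far i.
  by rewrite /far; case: ifP => // _; rewrite divr_ge0 ?mulr_ge0 ?exprn_ge0.
have slc0 i : 0 <= slc i.
  by rewrite /slc; case: ifP => // _; rewrite divr_ge0 ?exprn_ge0.
have mid0 i j k : 0 <= mid i j k.
  rewrite /mid; case: ifP => // _.
  by rewrite le_min !divr_ge0 ?mulr_ge0 ?exprn_ge0.
apply: le_trans (_ : \sum_(t <- box3 m) (far (maxc t) + slc (maxc t) +
    mid `|t.1.1|%N `|t.1.2|%N `|t.2|%N) <= _).
  apply: ler_sum => t _; rewrite /fibre_error -/(maxc t).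
  case: ifP => A0; last by rewrite !addr_ge0.
  have M0 : (0 < maxc t)%N by rewrite /maxc; lia.
  rewrite {1}/slc /mid A0 M0 -/(maxc t) /=.
  case: (leP (maxc t)%:R Y) => MY; first by rewrite -addrA lerDr.
  by rewrite /far MY -addrA lerDl addr0.
rewrite !big_split /=.
have -> : (864 + 128 * n.+1%:R * n.+2%:R) * Y ^+ n.+2 =
  96 * (8 * Y ^+ n.+2) + 96 * (Y ^+ n.+2) +
  8 * (16 * n.+1%:R * n.+2%:R * Y ^+ n.+2) by ring.
apply: lerD; first apply: lerD.
- apply: le_trans (sum_box3_maxc_le m far0 _) _.
    by rewrite /far ltNge Y1.
  by rewrite ler_wpM2l // sum_far_le.
- apply: le_trans (sum_box3_maxc_le m slc0 _) _; first by rewrite /slc ltnn.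
  by rewrite ler_wpM2l // sum_slice_le // ltnW.
- apply: le_trans (sum_box3_le m mid0) _.
  by rewrite ler_wpM2l // riemann_error_sum_le.
Qed.

(** * Lattice points in a fibre *)

(** The vectors [v = (b, d, q)] such that [(b / q, d / q)] lies on the fibre over
[t = (a : c : z)]. Together with their negatives and those with [q = 0] they form a
lattice of rank two; [q > 0] selects one of [v] and [- v]. *)
Definition on_lattice (n : nat) (t v : int * int * int) : bool :=
  (0 < v.2) && (t.1.1 * v.1.2 - t.1.2 * v.1.1 == v.2 * t.2 ^+ n.+1).

(** The height without the exponent [(n + 2) / n], for coprime [v] and [t]: see
[height_fibre_pt]. *)
Definition lheight (n : nat) (t v : int * int * int) : nat :=
  maxn (`|v.2| * maxc t ^ n) (maxn `|v.1.1| `|v.1.2|).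

Definition gcd3 (v : int * int * int) : nat :=
  gcdn (gcdn `|v.1.1| `|v.1.2|) `|v.2|.

(** The box makes the set finite; all [m >= s] give the same count. *)
Definition lattice_count (R : realType) (n : nat) (t : int * int * int)
    (m : nat) (s : R) : nat :=
  count (fun v => on_lattice n t v && ((lheight n t v)%:R <= s)) (box3 m).

Definition primitive_count (R : realType) (n : nat) (t : int * int * int)
    (m : nat) (s : R) : nat :=
  count (fun v => [&& on_lattice n t v, (lheight n t v)%:R <= s & gcd3 v == 1%N])
    (box3 m).

Definition scale3 (k : nat) (v : int * int * int) : int * int * int :=
  (k%:Z * v.1.1, k%:Z * v.1.2, k%:Z * v.2).

Lemma scale3_inj (k : nat) : (0 < k)%N -> injective (scale3 k).
Proof.
move=> k0 [[x y] z] [[x' y'] z']; have k1 : k%:Z != 0 by lia.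
by rewrite /scale3 /= => -[/(mulfI k1) -> /(mulfI k1) -> /(mulfI k1) ->].
Qed.

Lemma on_lattice_scale (n k : nat) (t v : int * int * int) : (0 < k)%N ->
  on_lattice n t (scale3 k v) = on_lattice n t v.
Proof.
move=> k0; rewrite /on_lattice /= pmulr_rgt0; last by lia.
have k1 : k%:Z != 0 by lia.
have -> : t.1.1 * (k%:Z * v.1.2) - t.1.2 * (k%:Z * v.1.1) =
   k%:Z * (t.1.1 * v.1.2 - t.1.2 * v.1.1) by ring.
by rewrite -[_ * v.2 * _]mulrA (inj_eq (mulfI k1)).
Qed.

Lemma lheight_scale (n k : nat) (t v : int * int * int) :
  lheight n t (scale3 k v) = (k * lheight n t v)%N.
Proof. by rewrite /lheight /= !abszM absz_nat -mulnA -!maxnMr. Qed.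

Lemma dvdn_gcd3_scale (k : nat) (v : int * int * int) :
  (k %| gcd3 v)%N -> exists u, v = scale3 k u.
Proof.
case: v => [[x y] z]; rewrite /gcd3 /= !dvdn_gcd => /andP[/andP[kx ky] kz].
have [x' ->] : exists x', x = k%:Z * x'.
  by have /dvdzP[x' ->] : (k%:Z %| x)%Z by []; exists x'; rewrite mulrC.
have [y' ->] : exists y', y = k%:Z * y'.
  by have /dvdzP[y' ->] : (k%:Z %| y)%Z by []; exists y'; rewrite mulrC.
have [z' ->] : exists z', z = k%:Z * z'.
  by have /dvdzP[z' ->] : (k%:Z %| z)%Z by []; exists z'; rewrite mulrC.
by exists (x', y', z').
Qed.

Lemma gcd3_scale (k : nat) (v : int * int * int) :
  gcd3 (scale3 k v) = (k * gcd3 v)%N.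
Proof. by rewrite /gcd3 /= !abszM absz_nat -!muln_gcdr. Qed.

Lemma lheight_le_box (n m : nat) (t v : int * int * int) :
  (0 < maxc t)%N -> (lheight n t v <= m)%N -> v \in box3 m.
Proof.
move=> M0; rewrite mem_box3 /lheight !geq_max => /and3P[qm -> ->] /=.
by apply: leq_trans qm; rewrite leq_pmulr // expn_gt0 M0.
Qed.

(** Division by [k] turns the multiples of [k] of height at most [T] into all lattice
points of height at most [T / k]. *)
Lemma lattice_count_scale (R : realType) (n m k : nat) (t : int * int * int)
    (T : R) : (0 < maxc t)%N -> (0 < k)%N -> T <= m%:R ->
  count (fun v => [&& on_lattice n t v, (lheight n t v)%:R <= T &
                      (k %| gcd3 v)%N]) (box3 m) =
  lattice_count n t m (T / k%:R).
Proof.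
move=> M0 k0 Tm; rewrite /lattice_count -!size_filter.
rewrite -[RHS](size_map (scale3 k)); apply: perm_size; apply: uniq_perm.
- by rewrite filter_uniq // box3_uniq.
- by rewrite (map_inj_uniq (scale3_inj k0)) filter_uniq // box3_uniq.
have kR : 0 < k%:R :> R by rewrite ltr0n.
move=> v; rewrite mem_filter; apply/idP/mapP => [|[u]].
  move=> /andP[/and3P[lv hv /dvdn_gcd3_scale[u vE]] vm].
  move: lv hv vm; rewrite {}vE on_lattice_scale // lheight_scale => lu hu um.
  exists u => //; rewrite mem_filter lu ler_pdivlMr // mulrC -natrM hu /=.
  move: um; rewrite !mem_box3 /= !abszM absz_nat => /and3P[h1 h2 h3].
  by apply/and3P; split; [apply: leq_trans h1|apply: leq_trans h2|apply: leq_trans h3];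
    rewrite leq_pmull.
rewrite mem_filter => /andP[/andP[lu hu] um] ->.
have hku : (k * lheight n t u)%:R <= T :> R.
  by rewrite natrM mulrC -ler_pdivlMr.
rewrite on_lattice_scale // lu lheight_scale hku gcd3_scale dvdn_mulr //=.
apply: (lheight_le_box (n := n) M0); rewrite lheight_scale.
by rewrite -(ler_nat R); apply: le_trans Tm.
Qed.

Lemma primitive_countE (R : realType) (n m N : nat) (t : int * int * int) (T : R) :
  (0 < maxc t)%N -> T <= m%:R -> T <= N%:R ->
  (primitive_count n t m T)%:Z =
  \sum_(1 <= k < N.+1) moebius k * (lattice_count n t m (T / k%:R))%:Z.
Proof.
move=> M0 Tm TN.
pose P v := on_lattice n t v && ((lheight n t v)%:R <= T).
transitivity (\sum_(v <- box3 m | P v)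
    \sum_(1 <= k < N.+1 | (k %| gcd3 v)%N) moebius k).
  rewrite /primitive_count -natz -sum1_count natr_sum.
  rewrite (eq_bigl (fun v => P v && (gcd3 v == 1%N))); last first.
    by move=> v; rewrite /P andbA.
  rewrite big_mkcondr /=; apply: eq_bigr => v /andP[lv hv].
  rewrite sum_moebius_dvd; first by case: eqP.
  move: lv; rewrite /on_lattice => /andP[q0 _].
  have qN : (`|v.2| <= N)%N.
    rewrite -(ler_nat R); apply: le_trans TN; apply: le_trans hv; rewrite ler_nat.
    by rewrite /lheight leq_max leq_pmulr ?expn_gt0 ?M0.
  have q1 : (0 < `|v.2|)%N by lia.
  rewrite /gcd3 gcdn_gt0 q1 orbT /=; apply: leq_trans qN.
  by rewrite dvdn_leq ?dvdn_gcdr.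
under eq_bigr do rewrite big_mkcond.
rewrite exchange_big /= big_nat [RHS]big_nat; apply: eq_bigr => k /andP[k0 _].
rewrite -(lattice_count_scale n M0 k0 Tm) -natz -sum1_count natr_sum mulr_sumr.
rewrite -big_mkcondr /=; apply: eq_big => [v|v _]; last by rewrite mulr1.
by rewrite /P -andbA.
Qed.

(** * Integers in an interval and in a residue class *)

(** The integers in question correspond to the integers between [(x - r) / d] and
[(y - r) / d]. *)
Lemma count_itv_progression (R : realType) (m d : nat) (r : int) (x y : R) :
  (0 < d)%N -> - m%:R <= x -> y <= m%:R ->
  `|(count (fun b : int => [&& x <= b%:~R, b%:~R <= y & (d%:Z %| b - r)%Z])
      (ibox m))%:R - Num.max 0 (y - x) / d%:R| <= 1 :> R.
Proof.
move=> d0 mx ym; have dR : 0 < d%:R :> R by rewrite ltr0n.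
have d1 : d%:Z != 0 by lia.
set P := fun _ => _.
pose x' := (x - r%:~R) / d%:R; pose y' := (y - r%:~R) / d%:R.
have xx' (j : int) : (x <= (r + d%:Z * j)%:~R) = (x' <= j%:~R).
  by rewrite /x' ler_pdivrMr // lerBlDl intrD intrM mulrC.
have yy' (j : int) : ((r + d%:Z * j)%:~R <= y) = (j%:~R <= y').
  by rewrite /y' ler_pdivlMr // lerBrDl intrD intrM mulrC.
pose lo := Num.ceil x'; pose hi := Num.floor y'.
pose K := if lo <= hi then (`|hi - lo|%N).+1 else 0%N.
have -> : count P (ibox m) = K.
  rewrite -size_filter -[RHS](size_iota 0).
  rewrite -[RHS](size_map (fun i : nat => r + d%:Z * (lo + i%:Z))).
  apply: perm_size; apply: uniq_perm.
  - by rewrite filter_uniq // ibox_uniq.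
  - rewrite map_inj_uniq ?iota_uniq // => i j /addrI /(mulfI d1) /addrI; lia.
  move=> b; rewrite mem_filter mem_ibox; apply/idP/mapP => [/andP[]|[i]].
    move=> /and3P[xb yb /dvdzP[j bE]] _.
    have {}bE : b = r + d%:Z * j by rewrite mulrC -bE addrC subrK.
    move: xb yb; rewrite bE xx' yy' -ceil_le_int -floor_ge_int -/lo -/hi => loj jhi.
    exists `|j - lo|%N; last by congr (_ + _ * _); lia.
    rewrite mem_iota /K.
    by rewrite (le_trans loj jhi); lia.
  rewrite mem_iota /K; case: ifP => lohi; last by rewrite andbF.
  move=> /andP[_ iK] ->; set j := lo + i%:Z.
  have xb : x <= (r + d%:Z * j)%:~R by rewrite xx' -ceil_le_int -/lo /j; lia.
  have yb : (r + d%:Z * j)%:~R <= y by rewrite yy' -floor_ge_int -/hi /j; lia.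
  rewrite /P xb yb addrC addKr dvdz_mulr //=.
  have := le_trans mx xb; have := le_trans yb ym.
  by rewrite -[m%:R]/(m%:Z%:~R) -rmorphN /= !ler_int; lia.
have -> : Num.max 0 (y - x) / d%:R = Num.max 0 (y' - x').
  rewrite maxr_pMl ?invr_ge0 ?ler0n // mul0r; congr (Num.max _ _).
  by rewrite /x' /y'; field; rewrite gt_eqF.
have [clo1 clo2] : lo%:~R - 1 < x' /\ x' <= lo%:~R.
  by have := ceil_itv x'; rewrite -/lo intrB => /andP[].
have [chi1 chi2] : hi%:~R <= y' /\ y' < hi%:~R + 1.
  by have := floor_itv y'; rewrite -/hi intrD => /andP[].
rewrite /K; case: ifPn => lohi.
  have -> : (`|hi - lo|%N.+1)%:R = hi%:~R - lo%:~R + 1 :> R.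
    rewrite -natr1 -[X in X + 1]/((`|hi - lo|%N)%:Z%:~R) gez0_abs ?intrB //.
    by rewrite subr_ge0.
  have : lo%:~R <= hi%:~R :> R by rewrite ler_int.
  by rewrite ler_norml; case: (leP 0 (y' - x')) => h lohi'; apply/andP; split; lra.
have : hi%:~R + 1 <= lo%:~R :> R.
  by rewrite -[1]/(1%:~R) -intrD ler_int; lia.
by rewrite ler_norml; case: (leP 0 (y' - x')) => h lohi'; apply/andP; split; lra.
Qed.

(** * Slices of a fibre *)

(** The length of the interval of all [b] with [|b| <= 1] and [|b c + v| <= |a|],
as a function of the absolute values of [a], [c] and [v]. *)
Definition slice_length (R : realType) (alpha gamma u : R) : R :=
  if gamma == 0 then (if u <= alpha then 2 else 0)
  else Num.max 0 (Num.min (Num.min 2 (2 * alpha / gamma))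
                          (1 + alpha / gamma - u / gamma)).

(** The interval is [-1, 1] cut with the one of radius [|a / c|] around [- v / c]; the
length of the intersection is the least of four differences of endpoints. *)
Lemma slice_itv (R : realType) (a c v : R) : a != 0 ->
  exists x y : R, [/\ -1 <= x, y <= 1,
    forall b, (`|b| <= 1) && (`|b * c + v| <= `|a|) = (x <= b <= y) &
    Num.max 0 (y - x) = slice_length `|a| `|c| `|v|].
Proof.
move=> a0; rewrite /slice_length normr_eq0.
have [->|c0] := eqVneq c 0.
  case: ifP => va.
    exists (-1), 1; split=> //; last by rewrite max_r; lra.
    by move=> b; rewrite mulr0 add0r va andbT ler_norml.
  exists 1, 0; split; [by lra|by lra| |].
    move=> b; rewrite mulr0 add0r va andbF; apply/esym/negbTE/negP => /andP[].
    by lra.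
  by rewrite sub0r max_l // oppr_le0 ler01.
have g0 : 0 < `|c| by rewrite normr_gt0.
set rho := `|a| / `|c|; set tau := v / c.
have rho0 : 0 <= rho by rewrite divr_ge0.
exists (Num.max (-1) (- tau - rho)), (Num.min 1 (- tau + rho)).
have e1 : 2 * `|a| / `|c| = 2 * rho by rewrite mulrA.
have e2 : `|v| / `|c| = `|tau| by rewrite /tau normrM normfV.
split; rewrite ?le_max ?lexx ?ge_min ?lexx //.
  move=> b.
  have -> : (`|b * c + v| <= `|a|) = (`|b + tau| <= rho).
    rewrite /rho ler_pdivlMr // -normrM mulrDl /tau divfK //.
  rewrite !ler_norml ge_max le_min.
  by apply/idP/idP => /andP[/andP[? ?] /andP[? ?]]; do !(apply/andP; split); lra.
rewrite e1 e2; clearbody rho tau; clear -rho0.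
rewrite /Num.max /Num.min.
case: (ger0P tau) => t0;
repeat match goal with |- context [if ?b then _ else _] => case: ifPn end;
rewrite -?leNgt => *; lra.
Qed.

Lemma slice_length_ge0 (R : realType) (alpha gamma u : R) :
  0 <= slice_length alpha gamma u.
Proof.
by rewrite /slice_length; case: ifP => _; [case: ifP|rewrite le_max lexx].
Qed.

Lemma slice_length_le2 (R : realType) (alpha gamma u : R) :
  slice_length alpha gamma u <= 2.
Proof.
rewrite /slice_length; case: ifP => _; first by case: ifP.
by rewrite ge_max ler0n !ge_min lexx.
Qed.

Lemma slice_length_le_ratio (R : realType) (alpha gamma u : R) :
  0 <= alpha -> 0 < gamma -> slice_length alpha gamma u <= 2 * alpha / gamma.
Proof.
move=> a0 g0; rewrite /slice_length gt_eqF // ge_max !ge_min lexx orbT /= andbT.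
by rewrite divr_ge0 ?mulr_ge0 // ltW.
Qed.

Lemma slice_length_noninc (R : realType) (alpha gamma u u' : R) :
  0 <= gamma -> u <= u' -> slice_length alpha gamma u' <= slice_length alpha gamma u.
Proof.
move=> g0 uu; rewrite /slice_length; case: ifPn => g1.
  by case: ifP => u'a; [rewrite (le_trans uu u'a)|case: ifP].
have H : u / gamma <= u' / gamma by rewrite ler_wpM2r // invr_ge0.
rewrite /Num.max /Num.min.
repeat match goal with |- context [if ?b then _ else _] => case: ifPn end;
rewrite -?leNgt => *; lra.
Qed.

Lemma slice_length_eq0 (R : realType) (alpha gamma u : R) :
  0 <= alpha -> 0 <= gamma -> alpha + gamma < u -> slice_length alpha gamma u = 0.
Proof.
move=> a0 g0 ug; rewrite /slice_length; case: ifPn => [_|g1].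
  by rewrite ifF //; apply/negbTE; rewrite -ltNge; lra.
have g2 : 0 < gamma by rewrite lt_def g1.
apply: max_l; rewrite ge_min; apply/orP; right.
have -> : 1 + alpha / gamma - u / gamma = (alpha + gamma - u) / gamma.
  by field.
by rewrite pmulr_lle0 ?invr_gt0 //; lra.
Qed.

(** Both sides are the length of the intersection of two intervals of radii [alpha] and
[gamma] at distance [u], divided by [alpha gamma]. This is why the two formulas for
[omega] agree. *)
Lemma slice_lengthC (R : realType) (alpha gamma u : R) :
  0 < alpha -> 0 < gamma ->
  slice_length alpha gamma u / alpha = slice_length gamma alpha u / gamma.
Proof.
move=> a0 g0; rewrite /slice_length !gt_eqF //.
have i1 : 0 <= alpha^-1 by rewrite invr_ge0 ltW.
have i2 : 0 <= gamma^-1 by rewrite invr_ge0 ltW.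
rewrite !maxr_pMl // !minr_pMl // !mul0r; congr (Num.max _ _).
rewrite [Num.min (2 / alpha) _]minC; congr (Num.min (Num.min _ _) _).
- by field; rewrite !gt_eqF.
- by field; rewrite !gt_eqF.
- by field; rewrite !gt_eqF.
Qed.

(** Divided by [g], the coefficient [c] becomes invertible modulo [a / g]. *)
Lemma linear_congruence (a c Q : int) (g := gcdn `|a| `|c|) : a != 0 ->
  (g%:Z %| Q)%Z ->
  exists r : int, forall b : int,
    (a %| c * b + Q)%Z = ((`|a| %/ g)%N%:Z %| b - r)%Z.
Proof.
move=> a0 /dvdzP[Q' QE].
have g0 : (0 < g)%N by rewrite gcdn_gt0; lia.
have [u [v uvg]] := Bezoutz a c.
have /dvdzP[a' aE] : (g%:Z %| a)%Z by apply: dvdn_gcdl.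
have /dvdzP[c' cE] : (g%:Z %| c)%Z by apply: dvdn_gcdr.
have gz : g%:Z != 0 by lia.
have gcdE : gcdz a c = g%:Z by [].
have cop : coprimez a' c'.
  apply/coprimezP; exists (u, v) => /=; apply: (mulIf gz).
  by rewrite mul1r mulrDl -!mulrA -aE -cE uvg.
exists (- (v * Q')) => b.
have -> : c * b + Q = c * (b - - (v * Q')) + a * (u * Q').
  have -> : Q = Q' * (u * a + v * c) by rewrite uvg gcdE.
  by ring.
rewrite rpredDr; last by apply: dvdz_mulr; apply: dvdzz.
set x := b - _.
rewrite {1}aE cE mulrAC dvdz_mul2r // Gauss_dvdzr //.
have -> : (`|a| %/ g)%N = `|a'|%N by rewrite aE abszM absz_nat mulnK.
by rewrite !dvdzE.
Qed.

Lemma linear_congruence0 (a c Q b : int) (g := gcdn `|a| `|c|) :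
  ~~ (g%:Z %| Q)%Z -> (a %| c * b + Q)%Z = false.
Proof.
move=> gQ; apply: contraNF gQ => aQ.
have gc : (g%:Z %| c * b)%Z.
  by apply: dvdz_mulr; apply: dvdn_gcdr.
have : (g%:Z %| c * b + Q)%Z by apply: dvdz_trans aQ; apply: dvdn_gcdl.
by rewrite rpredDl.
Qed.

Definition slice_count (R : realType) (m : nat) (a c Q : int) (s : R) : nat :=
  \sum_(b <- ibox m) \sum_(d <- ibox m)
    (((a * d - c * b)%R == Q) && ((maxn `|b|%N `|d|%N)%:R <= s)%R).

Lemma natr_absz_norm (R : realType) (x : int) : (`|x|%N)%:R = `|x%:~R : R|.
Proof. by rewrite natr_absz intr_norm. Qed.

Lemma slice_countE (R : realType) (m : nat) (a c Q : int) (s : R) :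
  a != 0 -> s <= m%:R ->
  slice_count m a c Q s =
  count (fun b : int => [&& `|b%:~R| <= s, (a %| c * b + Q)%Z &
     `|(c * b + Q)%:~R| <= s * `|a%:~R|]) (ibox m).
Proof.
move=> a0 sm; rewrite /slice_count -sum1_count [RHS]big_mkcond /=.
have aR : 0 < `|a%:~R : R| by rewrite normr_gt0 intr_eq0.
apply: eq_bigr => b _.
have [/dvdzP[e eE]|na] := boolP (a %| c * b + Q)%Z; last first.
  rewrite andbF /= big1 // => d _; case: eqP => // adQ; case/negP: na.
  by rewrite -adQ addrC subrK dvdz_mulr.
rewrite eE intrM normrM ler_pM2r //=.
under eq_bigr => d _.
  have -> : (a * d - c * b == Q) = (d == e).
    rewrite -[RHS](inj_eq (mulfI a0)) [a * e]mulrC -eE -[LHS]subr_eq0 -[RHS]subr_eq0.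
    by congr (_ == _); ring.
  over.
have mE (x : int) : `|x%:~R| <= s -> (`|x| <= m)%N.
  by rewrite -natr_absz_norm => xs; rewrite -(ler_nat R); apply: le_trans sm.
case: (boolP (_ && _)) => [/andP[bs es]|nbe].
  rewrite (bigD1_seq e) ?mem_ibox ?ibox_uniq //= ?mE // big1 ?addn0.
    by rewrite eqxx /= natr_max ge_max !natr_absz_norm bs es.
  by move=> d /negbTE ->.
rewrite big1 // => d _; case: eqP => //= ->.
by rewrite natr_max ge_max !natr_absz_norm (negbTE nbe).
Qed.

(** For given [b] at most one [d] solves the equation, so this counts the [b] in an
interval and in a residue class modulo [|a| / g]. *)
Lemma slice_count_estimate (R : realType) (m : nat) (a c Q : int) (s : R)
    (g := gcdn `|a| `|c|) :
  a != 0 -> 0 < s -> s <= m%:R -> (g%:Z %| Q)%Z ->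
  `|(slice_count m a c Q s)%:R -
    g%:R * s * (slice_length `|a|%N%:R `|c|%N%:R (`|Q|%N%:R / s) / `|a|%N%:R)| <= 1.
Proof.
move=> a0 s0 sm gQ; rewrite slice_countE //.
have [r rE] := linear_congruence a0 gQ.
have aR : a%:~R != 0 :> R by rewrite intr_eq0.
have [x [y [x1 y1 xyE xyL]]] := slice_itv c%:~R (Q%:~R / s) aR.
have s1 := ltW s0.
have ga : (g %| `|a|)%N by apply: dvdn_gcdl.
have g0 : (0 < g)%N by rewrite gcdn_gt0; lia.
have d0 : (0 < `|a| %/ g)%N.
  by rewrite divn_gt0 // dvdn_leq //; lia.
have sx : - m%:R <= s * x.
  apply: le_trans (_ : s * (-1) <= _); last by rewrite ler_pM2l.
  by rewrite mulrN1 lerN2.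
have sy : s * y <= m%:R.
  by apply: le_trans sm; rewrite -[leRHS]mulr1 ler_pM2l.
have := count_itv_progression r d0 sx sy.
have -> : Num.max 0 (s * y - s * x) = s * Num.max 0 (y - x).
  by rewrite maxr_pMr // mulr0 mulrBr.
rewrite xyL.
have -> : s * slice_length `|a%:~R| `|c%:~R| `|Q%:~R / s| / (`|a| %/ g)%N%:R =
   g%:R * s * (slice_length `|a|%N%:R `|c|%N%:R (`|Q|%N%:R / s) / `|a|%N%:R) :> R.
  rewrite !natr_absz_norm [ `|_ / s|]normrM normfV (gtr0_norm s0).
  have e1 : g%:R != 0 :> R by rewrite pnatr_eq0 -lt0n.
  have e2 : (`|a| %/ g)%N%:R != 0 :> R by rewrite pnatr_eq0 -lt0n.
  set L := slice_length _ _ _.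
  rewrite -natr_absz_norm -[in RHS](divnK ga) natrM.
  by field; rewrite e1 e2.
congr (`|_%:R - _| <= 1); apply: eq_count => b.
rewrite -rE; set D := (a %| _)%Z.
have -> : `|b%:~R : R| <= s = (`|b%:~R / s| <= 1).
  by rewrite normrM normfV (gtr0_norm s0) ler_pdivrMr // mul1r.
have -> : `|(c * b + Q)%:~R| <= s * `|a%:~R : R| =
    (`|b%:~R / s * c%:~R + Q%:~R / s| <= `|a%:~R|).
  have -> : b%:~R / s * c%:~R + Q%:~R / s = (c * b + Q)%:~R / s.
    by rewrite intrD intrM; field; rewrite gt_eqF.
  by rewrite normrM normfV (gtr0_norm s0) ler_pdivrMr // [s * _]mulrC.
rewrite [RHS]andbCA [RHS]andbC xyE.
rewrite ler_pdivlMr // ler_pdivrMr // mulrC [y * s]mulrC.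
by rewrite andbA.
Qed.

Lemma slice_count_eq0 (R : realType) (m : nat) (a c Q : int) (s : R)
    (g := gcdn `|a| `|c|) :
  a != 0 -> s <= m%:R -> ~~ (g%:Z %| Q)%Z -> slice_count m a c Q s = 0%N.
Proof.
move=> a0 sm gQ; rewrite slice_countE //; apply/eqP; rewrite -leqn0 leqNgt -has_count.
by apply/hasPn => b _; rewrite linear_congruence0 // andbF.
Qed.

Lemma lattice_count_slices (R : realType) (n m : nat) (t : int * int * int) (s : R) :
  lattice_count n t m s =
  \sum_(1 <= q < m.+1 | (q * maxc t ^ n)%N%:R <= s)
    slice_count m t.1.1 t.1.2 (q%:Z * t.2 ^+ n.+1)%R s.
Proof.
rewrite /lattice_count -sum1_count big_mkcond big_box3 /=.
under eq_bigr do rewrite exchange_big /=.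
rewrite exchange_big /= (bigID (fun q : int => 0 < q)) /=.
rewrite addrC big1 ?add0r; last first.
  move=> q /negbTE q0; rewrite big1 // => b _; rewrite big1 // => d _.
  by rewrite /on_lattice /= q0.
rewrite -big_filter (perm_big [seq q%:Z | q <- index_iota 1 m.+1]); last first.
  apply: uniq_perm.
  - by rewrite filter_uniq // ibox_uniq.
  - by rewrite map_inj_uniq ?iota_uniq // => i j [].
  move=> q; rewrite mem_filter mem_ibox; apply/idP/mapP => [qm|[i]].
    by exists `|q|%N; rewrite ?mem_index_iota; lia.
  by rewrite mem_index_iota => im ->; lia.
rewrite big_map [RHS]big_mkcond /= big_nat [RHS]big_nat.
apply: eq_bigr => q /andP[q0 _]; rewrite /slice_count /on_lattice /lheight /=.
case: ifPn => qs.
  apply: eq_bigr => b _; apply: eq_bigr => d _.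
  by rewrite natr_max ge_max qs /= ltz_nat q0 /=; case: (_ && _).
rewrite big1 // => b _; rewrite big1 // => d _.
by rewrite natr_max ge_max (negbTE qs) andbF.
Qed.

(** The length of the slice at height [w >= 0] of the region that defines
[omega], divided by the covolume [|a|] of the lattice in that slice. *)
Definition slice_density (R : realType) (n i j k : nat) (w : R) : R :=
  if w * (maxn (maxn i j) k)%:R ^+ n <= 1 then
    slice_length i%:R j%:R (k%:R ^+ n.+1 * w) / i%:R
  else 0.

(** Since [g] is coprime to [z], only the heights [q] divisible by [g] carry lattice
points; each of the at most [s / M ^ n] slices contributes a rounding error at
most [1]. *)
Lemma lattice_count_estimate (R : realType) (n m : nat) (t : int * int * int)
    (s : R) (g := gcdn `|t.1.1| `|t.1.2|) :
  (0 < n)%N -> t.1.1 != 0 -> gcd3 t = 1%N -> 0 < s -> s <= m%:R ->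
  `|(lattice_count n t m s)%:R - \sum_(1 <= j < m.+1)
     g%:R * s * slice_density n `|t.1.1| `|t.1.2| `|t.2| (g%:R * j%:R / s)| <=
  s / (maxc t)%:R ^+ n.
Proof.
move=> n0 a0 t1 s0 sm; have s1 := ltW s0.
have g0 : (0 < g)%N by rewrite gcdn_gt0; lia.
have M0 : (0 < maxc t)%N by rewrite /maxc; lia.
have MR : 0 < (maxc t)%:R ^+ n :> R by rewrite exprn_gt0 // ltr0n.
have gz : coprime g (`|t.2| ^ n.+1) by rewrite coprimeXr // /coprime -/(gcd3 t) t1.
pose F (q : nat) : R :=
  g%:R * s * slice_density n `|t.1.1| `|t.1.2| `|t.2| (q%:R / s).
have qs (q : nat) : (q%:R / s * (maxc t)%:R ^+ n <= 1) = ((q * maxc t ^ n)%N%:R <= s).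
  by rewrite mulrAC ler_pdivrMr // mul1r natrM natrX.
have -> : \sum_(1 <= j < m.+1) g%:R * s *
     slice_density n `|t.1.1| `|t.1.2| `|t.2| (g%:R * j%:R / s) =
   \sum_(1 <= q < m.+1 | (g %| q)%N && ((q * maxc t ^ n)%N%:R <= s)) F q.
  transitivity (\sum_(1 <= j < m.+1 | (g * j * maxc t ^ n)%N%:R <= s) F (g * j)%N).
    rewrite [RHS]big_mkcond /=; apply: eq_bigr => j _; rewrite -natrM.
    by rewrite -qs /F /slice_density -/(maxc t); case: ifP => //; rewrite mulr0.
  rewrite -[LHS]big_filter -[RHS]big_filter -(big_map (muln g) xpredT F) /=.
  apply: perm_big; apply: uniq_perm.
  - rewrite map_inj_uniq ?filter_uniq ?iota_uniq // => x y /eqP.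
    by rewrite eqn_pmul2l // => /eqP.
  - by rewrite filter_uniq ?iota_uniq.
  move=> q; rewrite mem_filter mem_index_iota; apply/mapP/idP => [[j]|].
    rewrite mem_filter mem_index_iota => /andP[gjs /andP[j0 _]] ->.
    rewrite dvdn_mulr //= gjs muln_gt0 g0 j0 /= ltnS -(ler_nat R).
    apply: le_trans sm; apply: le_trans gjs; rewrite ler_nat.
    by rewrite leq_pmulr // expn_gt0 M0.
  move=> /andP[/andP[/dvdnP[j ->] jgs] /andP[jg0 jgm]].
  exists j; last by rewrite mulnC.
  rewrite mem_filter mem_index_iota mulnC [(g * j)%N]mulnC mulnC jgs /=.
  move: jg0; rewrite muln_gt0 => /andP[-> _] /=.
  by apply: leq_ltn_trans jgm; rewrite leq_pmulr.
rewrite lattice_count_slices (bigID (fun q => (g %| q)%N)) /= natrD.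
rewrite [X in _ + X%:R]big1 ?addr0; last first.
  move=> q /andP[_ gq]; apply: slice_count_eq0 => //.
  apply: contra gq; rewrite dvdzE abszM abszX absz_nat.
  by rewrite Gauss_dvdl.
rewrite natr_sum; under [X in _ - X]eq_bigl do rewrite andbC.
rewrite -sumrB; apply: le_trans (ler_norm_sum _ _ _) _.
apply: le_trans (_ : \sum_(1 <= q < m.+1 | (q * maxc t ^ n)%N%:R <= s) 1 <= _).
  rewrite [leRHS]big_mkcond /= big_mkcond /=.
  rewrite big_nat [leRHS]big_nat; apply: ler_sum => q /andP[q0 _].
  case: ifPn => [/andP[qMs gq]|_]; last by case: ifP.
  rewrite qMs; have gQ : (g%:Z %| q%:Z * t.2 ^+ n.+1)%Z.
    by rewrite dvdzE abszM absz_nat dvdn_mulr.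
  apply: le_trans (slice_count_estimate a0 s0 sm gQ).
  rewrite /F /slice_density -/(maxc t) qs qMs le_eqVlt; apply/orP; left; apply/eqP.
  congr (`|_ - _ * (slice_length _ _ _ / _)|).
  by rewrite abszM absz_nat natrM abszX natrX; field; rewrite gt_eqF.
apply: le_trans (_ : \sum_(1 <= q < m.+1) (q <= Num.truncn (s / (maxc t)%:R ^+ n))%N%:R
   <= _).
  rewrite big_mkcond; apply: ler_sum => q _.
  rewrite truncn_ge_nat; last by rewrite divr_ge0 // ltW.
  by rewrite ler_pdivlMr // -natrX -natrM; case: ifP.
apply: le_trans (_ : (Num.truncn (s / (maxc t)%:R ^+ n))%:R <= _); last first.
  by rewrite truncn_le divr_ge0 // ltW.
have := sum_leq_indicator R m.+1 (Num.truncn (s / (maxc t)%:R ^+ n)).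
by rewrite big_ltn // leq0n -nat1r lerD2l.
Qed.

(** * Integrals over the fibres *)

Lemma measure_centered_itv (R : realType) (r : R) : 0 <= r ->
  (@lebesgue_measure R) `[- r, r] = (2 * r)%:E.
Proof.
move=> r0; rewrite lebesgue_measure_itv /= lte_fin.
case: ifPn => [_|rr]; first by rewrite -EFinB opprK mulr_natl mulr2n.
by move: rr; rewrite -leNgt => rr; rewrite (_ : r = 0) ?mulr0 //; lra.
Qed.

(** The interval of radius [h k] is cut into symmetric pairs of intervals of
length [h], on which an even function monotone on each side of [0] varies between
its values at the ends. *)
Lemma riemann_bounds_centered (R : realType) (f : R -> R) (h : R) (k : nat) :
  0 < h -> (forall x, 0 <= f x) -> measurable_fun setT f ->
  (forall x y, `|x| <= `|y| -> f y <= f x) ->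
  ((2 * h * \sum_(1 <= j < k.+1) f (h * j%:R))%R%:E <=
   \int[@lebesgue_measure R]_(x in `[(- (h * k%:R))%R, (h * k%:R)%R]) (f x)%:E <=
   (2 * h * \sum_(0 <= j < k) f (h * j%:R))%R%:E)%E.
Proof.
move=> h0 f0 mf fm; elim: k => [|k IH].
  rewrite !big_geq // !mulr0 oppr0 set_itv1 integral_set1 lexx //.
pose B (j : nat) : set R := `[- (h * j%:R), h * j%:R]%classic.
have mB j : measurable (B j) by exact: measurable_itv.
have hk j : 0 <= h * j%:R by rewrite mulr_ge0 // ltW.
have BE j x : B j x <-> `|x| <= h * j%:R.
  by rewrite /B /= in_itv /= ler_norml.
have kk : h * k%:R <= h * k.+1%:R by rewrite ler_pM2l // ler_nat.
pose A := B k.+1 `\` B k.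
have mA : measurable A by exact: measurableD.
have muB j : (@lebesgue_measure R) (B j) = (2 * (h * j%:R))%:E.
  exact: measure_centered_itv.
have muA : (@lebesgue_measure R) A = (2 * h)%:E.
  have BB : B k.+1 `&` B k = B k.
    apply/seteqP; split => x; first by case.
    by move=> xk; split => //; apply/BE; apply: le_trans kk; apply/BE.
  have Boo : ((@lebesgue_measure R) (B k.+1) < +oo)%E by rewrite muB ltry.
  have e := @measureD _ _ _ (@lebesgue_measure R) _ _ (mB k.+1) (mB k) Boo.
  rewrite BB in e; refine (etrans e _).
  refine (etrans (congr2 (fun x y => x - y)%E (muB k.+1) (muB k)) _).
  by rewrite -EFinB; congr (_%:E); rewrite -natr1; ring.
have BA : B k.+1 = B k `|` A.
  rewrite /A setDE setUIr setUv setIT; apply/esym/setUidPr => x /BE xk.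
  by apply/BE; apply: le_trans kk.
have mfE D := (measurable_EFinP D f).2
  (measurable_funS measurableT (@subsetT _ D) mf).
have dBA : [disjoint B k & A]%classic.
  apply/disj_set2P; apply/seteqP; split=> [x [xk [_ nxk]]|x []].
  exact: (nxk xk).
rewrite -/(B k.+1) BA ge0_integral_setU; last 5 first.
- exact: mB.
- exact: mA.
- exact: mfE.
- by move=> x _; rewrite lee_fin.
- exact: dBA.
have Alow : ((2 * h * f (h * k.+1%:R))%R%:E <=
    \int[@lebesgue_measure R]_(x in A) (f x)%:E)%E.
  rewrite mulrC EFinM -muA -integral_cst //.
  apply: ge0_le_integral; [exact: mA| |exact: measurable_cst|exact: mfE|].
    by move=> ? _; rewrite lee_fin.
  by move=> y [/BE yk _]; rewrite lee_fin; apply: fm; rewrite [leRHS]ger0_norm.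
have Aup : (\int[@lebesgue_measure R]_(x in A) (f x)%:E <=
    (2 * h * f (h * k%:R))%R%:E)%E.
  rewrite mulrC EFinM -muA -integral_cst //.
  apply: ge0_le_integral; [exact: mA| |exact: mfE|exact: measurable_cst|].
    by move=> ? _; rewrite lee_fin.
  move=> y [_ yk]; rewrite lee_fin; apply: fm; rewrite ger0_norm //.
  by rewrite leNgt; apply/negP => /ltW yk'; apply: yk; apply/BE.
case/andP: IH => IH1 IH2; apply/andP; split.
  by rewrite big_nat_recr //= mulrDr EFinD; apply: leeD.
by rewrite big_nat_recr //= mulrDr EFinD; apply: leeD.
Qed.

Lemma riemann_bounds (R : realType) (f : R -> R) (h : R) (k : nat) :
  0 < h -> (forall x, 0 <= f x) -> measurable_fun setT f ->
  (forall x y, `|x| <= `|y| -> f y <= f x) ->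
  (forall x, h * k%:R < `|x| -> f x = 0) ->
  ((2 * h * \sum_(1 <= j < k.+1) f (h * j%:R))%R%:E <=
   \int[@lebesgue_measure R]_x (f x)%:E <=
   (2 * h * \sum_(0 <= j < k) f (h * j%:R))%R%:E)%E.
Proof.
move=> h0 f0 mf fm fs; have := riemann_bounds_centered k h0 f0 mf fm.
have -> : (\int[@lebesgue_measure R]_(x in `[(- (h * k%:R))%R, (h * k%:R)%R]) (f x)%:E =
  \int[@lebesgue_measure R]_x (f x)%:E)%E => //.
rewrite integral_mkcond; apply: eq_integral => x _; rewrite patchE.
case: ifPn => // /negP xk; rewrite fs // ltNge; apply/negP => xk'; apply: xk.
by rewrite inE /= in_itv /= -ler_norml.
Qed.

Lemma measurable_strip (R : realType) (u v : R) :
  measurable [set p : R * R | `|u * p.1 + v * p.2| <= 1].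
Proof.
have mf : measurable_fun [set: R * R] (fun p : R * R => u * p.1 + v * p.2).
  apply: measurable_funD; apply: measurable_funM => //.
have {}mf := measurableT_comp (@normr_measurable R setT) mf.
have := measurable_fun_le measurableT mf (measurable_cst (1 : R)).
by rewrite setTI.
Qed.

(** The region of integration, with all conditions on [w] put together. *)
Definition fibre_region (R : realType) (m alpha gamma zeta : R) : set (R * R) :=
  [set p : R * R | [/\ `|p.2| * m <= 1, `|p.1| <= 1 &
                       `|p.1 * gamma + zeta * p.2| <= `|alpha|]].

Lemma measurable_fibre_region (R : realType) (m alpha gamma zeta : R) :
  0 <= m -> alpha != 0 -> measurable (fibre_region m alpha gamma zeta).
Proof.
move=> m0 a0.
have -> : fibre_region m alpha gamma zeta =
  [set p : R * R | `|0 * p.1 + m * p.2| <= 1] `&`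
  ([set p : R * R | `|1 * p.1 + 0 * p.2| <= 1] `&`
   [set p : R * R | `|gamma / alpha * p.1 + zeta / alpha * p.2| <= 1]).
  have a1 : 0 < `|alpha| by rewrite normr_gt0.
  apply/funext => -[b w]; apply/propext; rewrite /fibre_region /=.
  rewrite !mul0r mul1r addr0 add0r normrM (ger0_norm m0) [m * _]mulrC.
  have -> : gamma / alpha * b + zeta / alpha * w = (b * gamma + zeta * w) / alpha.
    by field.
  rewrite normrM normfV ler_pdivrMr // mul1r.
  by split=> [[? ? ?]|[? [? ?]]].
by do !apply: measurableI; exact: measurable_strip.
Qed.

Definition region_density (R : realType) (m alpha gamma zeta w : R) : R :=
  if `|w| * m <= 1 then slice_length `|alpha| `|gamma| `|zeta * w| / `|alpha|
  else 0.

Lemma region_integral (R : realType) (m alpha gamma zeta : R) :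
  0 <= m -> alpha != 0 ->
  measurable_fun setT (region_density m alpha gamma zeta) /\
  (\int[@plane_measure R]_(p in fibre_region m alpha gamma zeta) (`|alpha|^-1)%:E =
   \int[@lebesgue_measure R]_w (region_density m alpha gamma zeta w)%:E)%E.
Proof.
move=> m0 a0; set D := fibre_region _ _ _ _.
have mD : measurable D by exact: measurable_fibre_region.
pose F : R * R -> \bar R := (cst (`|alpha|^-1)%:E) \_ D.
have F0 p : (0 <= F p)%E.
  by rewrite /F patchE; case: ifP => // _; rewrite lee_fin invr_ge0.
have mF : measurable_fun setT F.
  by apply/(measurable_restrictT _ mD).
have GE w : fubini_G (@lebesgue_measure R) F w =
    (region_density m alpha gamma zeta w)%:E.
  rewrite /fubini_G.
  have -> : (fun x => F (x, w)) = (cst (`|alpha|^-1)%:E) \_ [set b | D (b, w)].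
    by apply/funext => b; rewrite /F !patchE.
  rewrite -integral_mkcond /region_density.
  have [x [y [_ _ xyE xyL]]] := slice_itv gamma (zeta * w) a0.
  case: ifPn => wm; last first.
    rewrite (_ : [set b | D (b, w)] = set0) ?integral_set0 //.
    by apply/seteqP; split => b //= -[] /=; rewrite (negbTE wm).
  have -> : [set b | D (b, w)] = `[x, y]%classic.
    apply/funext => b; apply/propext; rewrite /D /fibre_region /= in_itv /= -xyE.
    by split=> [[_ -> ->] //|/andP[-> ->]].
  rewrite integral_cst //= lebesgue_measure_itv /= -xyL lte_fin.
  case: ifPn => xy.
    by rewrite -EFinB -EFinM max_r ?subr_ge0 ?ltW // mulrC.
  by rewrite mule0 max_l ?mul0r // subr_le0 leNgt.
split.
  apply/measurable_EFinP.
  have -> : EFin \o region_density m alpha gamma zeta =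
      fubini_G (@lebesgue_measure R) F by apply/funext => w; rewrite GE.
  exact: measurable_fun_fubini_tonelli_G.
rewrite integral_mkcond /plane_measure fubini_tonelli2 //.
by apply: eq_integral => w _; exact: GE.
Qed.

(** The value of [omega] depends only on the absolute values of the coordinates. *)
Definition omega_nat (R : realType) (n i j k : nat) : R :=
  fine (\int[@lebesgue_measure R]_w (slice_density n i j k `|w|)%:E)%E.

Lemma region_slice_density (R : realType) (n i j k : nat)
    (alpha gamma zeta w : R) :
  `|alpha| = i%:R -> `|gamma| = j%:R -> `|zeta| = k%:R ^+ n.+1 ->
  region_density ((maxn (maxn i j) k)%:R ^+ n) alpha gamma zeta w =
  slice_density n i j k `|w|.
Proof.
by move=> ai gj zk; rewrite /region_density /slice_density normrM ai gj zk.
Qed.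

Lemma maxn_bound (R : realType) (n i j : nat) (w : R) : 0 <= w ->
  (w * (maxn i j)%:R ^+ n <= 1) = (w * i%:R ^+ n <= 1) && (w * j%:R ^+ n <= 1).
Proof.
move=> w0.
have mono (p q : nat) : (p <= q)%N -> w * q%:R ^+ n <= 1 -> w * p%:R ^+ n <= 1.
  move=> pq; apply: le_trans; rewrite ler_wpM2l // lerXn2r ?nnegrE //.
  by rewrite ler_nat.
have [ij|ji] : (maxn i j = j /\ (i <= j)%N) \/ (maxn i j = i /\ (j <= i)%N) by lia.
  case: ij => -> /mono ij; case: (boolP (w * j%:R ^+ n <= 1)) => [/ij ->|] //.
  by rewrite andbF.
case: ji => -> /mono ji; case: (boolP (w * i%:R ^+ n <= 1)) => [/ji ->|] //.
Qed.

Lemma omega_aE (R : realType) (n : nat) (a c z : int) : a != 0 ->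
  omega_a n (a%:~R : R) c%:~R z%:~R = omega_nat R n `|a| `|c| `|z|.
Proof.
move=> a0; have aR : a%:~R != 0 :> R by rewrite intr_eq0.
rewrite /omega_a /Rintegral /omega_nat; congr fine.
have M0 : 0 <= (maxn (maxn `|a| `|c|) `|z|)%:R ^+ n :> R by rewrite exprn_ge0.
have [_ E] := region_integral (c%:~R : R) (z%:~R ^+ n.+1) M0 aR.
transitivity (\int[@lebesgue_measure R]_w (region_density
  ((maxn (maxn `|a| `|c|) `|z|)%:R ^+ n) (a%:~R : R) c%:~R (z%:~R ^+ n.+1) w)%:E)%E.
  rewrite -E; congr (integral _ _ _); apply/funext => -[b w]; apply/propext => /=.
  rewrite /fibre_region /= !maxn_bound // !natr_absz_norm.
  rewrite !normrM !normrX normfV ![_ * `|w|]mulrC.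
  rewrite ler_pdivrMr ?normr_gt0 // mul1r.
  by split=> [[-> -> -> -> ->]|[/andP[/andP[-> ->] ->] -> ->]].
apply: eq_integral => w _; congr (_%:E); apply: region_slice_density.
- by rewrite natr_absz_norm.
- by rewrite natr_absz_norm.
- by rewrite natr_absz_norm normrX.
Qed.

Lemma omega_cE (R : realType) (n : nat) (a c z : int) : c != 0 ->
  omega_c n (a%:~R : R) c%:~R z%:~R = omega_nat R n `|c| `|a| `|z|.
Proof.
move=> c0; have cR : c%:~R != 0 :> R by rewrite intr_eq0.
rewrite /omega_c /Rintegral /omega_nat; congr fine.
have M0 : 0 <= (maxn (maxn `|c| `|a|) `|z|)%:R ^+ n :> R by rewrite exprn_ge0.
have [_ E] := region_integral (a%:~R : R) (- z%:~R ^+ n.+1) M0 cR.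
transitivity (\int[@lebesgue_measure R]_w (region_density
  ((maxn (maxn `|c| `|a|) `|z|)%:R ^+ n) (c%:~R : R) a%:~R (- z%:~R ^+ n.+1) w)%:E)%E.
  rewrite -E; congr (integral _ _ _); apply/funext => -[b w]; apply/propext => /=.
  rewrite /fibre_region /= !maxn_bound // !natr_absz_norm.
  rewrite !normrM !normrX normfV ![_ * `|w|]mulrC.
  rewrite ler_pdivrMr ?normr_gt0 // mul1r mulNr [b * _]mulrC.
  by split=> [[-> -> -> -> ->]|[/andP[/andP[-> ->] ->] -> ->]].
apply: eq_integral => w _; congr (_%:E); apply: region_slice_density.
- by rewrite natr_absz_norm.
- by rewrite natr_absz_norm.
- by rewrite natr_absz_norm normrN normrX.
Qed.

Lemma omega_natC (R : realType) (n i j k : nat) : (0 < i)%N -> (0 < j)%N ->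
  omega_nat R n i j k = omega_nat R n j i k.
Proof.
move=> i0 j0; congr fine; apply: eq_integral => w _; congr (_%:E).
by rewrite /slice_density [maxn j i]maxnC slice_lengthC ?ltr0n.
Qed.

Lemma slice_density_ge0 (R : realType) (n i j k : nat) (w : R) :
  0 <= slice_density n i j k w.
Proof.
rewrite /slice_density; case: ifP => // _.
by rewrite divr_ge0 ?slice_length_ge0.
Qed.

Lemma slice_density_le (R : realType) (n i j k : nat) (w : R) : (0 < i)%N ->
  slice_density n i j k w <= 2 / (maxn i j)%:R.
Proof.
move=> i0; have iR : 0 < i%:R :> R by rewrite ltr0n.
rewrite /slice_density; case: ifP => _; last by rewrite divr_ge0.
have [ij|ji] : (maxn i j = i \/ (maxn i j = j /\ (0 < j)%N))%N by lia.
  by rewrite ij ler_pM2r ?invr_gt0 // slice_length_le2.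
case: ji => -> j0; rewrite ler_pdivrMr // mulrAC.
by rewrite slice_length_le_ratio ?ltr0n.
Qed.

Lemma slice_density_noninc (R : realType) (n i j k : nat) (x y : R) :
  0 <= x -> x <= y -> slice_density n i j k y <= slice_density n i j k x.
Proof.
move=> x0 xy; rewrite {1}/slice_density; case: ifP => [yM|_]; last first.
  exact: slice_density_ge0.
rewrite /slice_density ifT; last first.
  by apply: le_trans yM; rewrite ler_wpM2r ?exprn_ge0.
by rewrite ler_wpM2r ?invr_ge0 // slice_length_noninc // ler_wpM2l // exprn_ge0.
Qed.

Lemma slice_density_eq0 (R : realType) (n i j k : nat) (x : R) :
  (1 < x * (maxn (maxn i j) k)%:R ^+ n) || ((i + j)%:R < k%:R ^+ n.+1 * x) ->
  slice_density n i j k x = 0.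
Proof.
move=> /orP[xM|kx]; rewrite /slice_density; first by rewrite leNgt xM.
case: ifP => // _; rewrite slice_length_eq0 ?mul0r //.
by rewrite -natrD.
Qed.

Lemma omega_nat_riemann (R : realType) (n i j k N : nat) (h : R) :
  (0 < i)%N -> 0 < h ->
  (forall x, h * N%:R < x -> slice_density n i j k x = 0) ->
  2 * h * \sum_(1 <= l < N.+1) slice_density n i j k (h * l%:R) <=
  omega_nat R n i j k <=
  2 * h * \sum_(0 <= l < N) slice_density n i j k (h * l%:R).
Proof.
move=> i0 h0 hN.
pose f (w : R) := slice_density n i j k `|w|.
have f0 x : 0 <= f x by apply: slice_density_ge0.
have iR : i%:R != 0 :> R by rewrite pnatr_eq0 -lt0n.
have M0 : 0 <= (maxn (maxn i j) k)%:R ^+ n :> R by rewrite exprn_ge0.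
have mf : measurable_fun setT f.
  have [mf _] := region_integral (j%:R : R) (k%:R ^+ n.+1) M0 iR.
  rewrite (_ : f = region_density ((maxn (maxn i j) k)%:R ^+ n) (i%:R : R)
    j%:R (k%:R ^+ n.+1)) //.
  apply/funext => w; apply/esym; apply: region_slice_density;
    by rewrite ger0_norm // exprn_ge0.
have fm x y : `|x| <= `|y| -> f y <= f x by apply: slice_density_noninc.
have fs x : h * N%:R < `|x| -> f x = 0 by apply: hN.
have fE (l : nat) : f (h * l%:R) = slice_density n i j k (h * l%:R).
  by rewrite /f ger0_norm // mulr_ge0 // ltW.
have := riemann_bounds h0 f0 mf fm fs.
under eq_bigr do rewrite fE.
under [X in _ && (_ <= (_ * _ * X)%:E)%E -> _]eq_bigr do rewrite fE.
rewrite /omega_nat -/f; case: (integral _ _ _) => [r| |];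
  by rewrite ?lee_fin // ?leye_eq ?leeNy_eq ?andbF.
Qed.

Lemma omega_nat_ge0 (R : realType) (n i j k : nat) : 0 <= omega_nat R n i j k.
Proof.
apply: fine_ge0; apply: integral_ge0 => w _.
by rewrite lee_fin slice_density_ge0.
Qed.

(** The density is at most [2 / A]. It vanishes for [w > M ^ (- n)], which settles the
case [M = A], and for [k ^ (n + 1) w > i + j], which settles the case [M = k]. *)
Lemma omega_nat_le (R : realType) (n i j k : nat) : (0 < i)%N ->
  omega_nat R n i j k <= 8 / (maxn (maxn i j) k)%:R ^+ n.+1.
Proof.
move=> i0; set A := maxn i j; set M := maxn A k.
have A0 : (0 < A)%N by rewrite /A; lia.
have AR : 0 < A%:R :> R by rewrite ltr0n.
have M0 : (0 < M)%N by rewrite /M; lia.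
have MR : 0 < M%:R :> R by rewrite ltr0n.
have bound (h : R) : 0 < h -> (forall x, h < x -> slice_density n i j k x = 0) ->
    omega_nat R n i j k <= 2 * h * (2 / A%:R).
  move=> h0 hs; have := @omega_nat_riemann R n i j k 1 h i0 h0.
  rewrite mulr1 => /(_ hs) /andP[_]; rewrite big_nat1 => /le_trans; apply.
  by rewrite ler_wpM2l ?slice_density_le // mulr_ge0 // ltW.
have [MA|[Mk kA]] : M = A \/ (M = k /\ (A < k)%N) by rewrite /M; lia.
  apply: le_trans (bound (M%:R ^- n) _ _) _.
  - by rewrite invr_gt0 exprn_gt0.
  - move=> x xM; apply: slice_density_eq0.
    by rewrite -/A -/M -ltr_pdivrMr ?exprn_gt0 // mul1r xM.
  rewrite -MA exprS; have -> : 2 * M%:R ^- n * (2 / M%:R) = 4 / (M%:R * M%:R ^+ n) :> R.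
    by field; rewrite !gt_eqF // exprn_gt0.
  by rewrite ler_pM2r ?ler_nat // invr_gt0 mulr_gt0 // exprn_gt0.
have kR : 0 < k%:R :> R by rewrite ltr0n; lia.
apply: le_trans (bound ((i + j)%:R / k%:R ^+ n.+1) _ _) _.
- by rewrite divr_gt0 ?exprn_gt0 // ltr0n; lia.
- move=> x xM; apply: slice_density_eq0; apply/orP; right.
  by rewrite mulrC -ltr_pdivrMr ?exprn_gt0.
rewrite Mk; set K := _ ^+ n.+1; have K0 : 0 < K by rewrite exprn_gt0.
have -> : 2 * ((i + j)%:R / K) * (2 / A%:R) = 4 * ((i + j)%:R / A%:R) / K :> R.
  by field; rewrite !gt_eqF.
rewrite ler_pM2r ?invr_gt0 // -[8]/((4 * 2)%N%:R) natrM ler_pM2l //.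
by rewrite ler_pdivrMr // -natrM ler_nat /A; lia.
Qed.

(** * The number of lattice points in a fibre *)

Definition omega_pt (R : realType) (n : nat) (t : int * int * int) : R :=
  if t.1.1 != 0 then omega_nat R n `|t.1.1| `|t.1.2| `|t.2|
  else omega_nat R n `|t.1.2| `|t.1.1| `|t.2|.

Definition swap_pt (t : int * int * int) : int * int * int :=
  ((t.1.2, t.1.1), t.2).

(** [(b, d)] solves [a d - b c = e] precisely when [(- d, - b)] solves the
equation with [a] and [c] exchanged. *)
Lemma lattice_count_swap (R : realType) (n m : nat) (t : int * int * int) (s : R) :
  lattice_count n (swap_pt t) m s = lattice_count n t m s.
Proof.
pose f (v : int * int * int) : int * int * int := ((- v.1.2, - v.1.1), v.2).
have ff : cancel f f by move=> [[b d] q]; rewrite /f /= !opprK.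
have bf v : (f v \in box3 m) = (v \in box3 m).
  by rewrite !mem_box3 /= !abszN andbCA.
rewrite /lattice_count -!size_filter -[RHS](size_map f).
apply: perm_size; apply: uniq_perm.
- by rewrite filter_uniq // box3_uniq.
- by rewrite (map_inj_uniq (can_inj ff)) filter_uniq // box3_uniq.
have E v : on_lattice n (swap_pt t) (f v) && ((lheight n (swap_pt t) (f v))%:R <= s)
  = on_lattice n t v && ((lheight n t v)%:R <= s).
  congr (_ && _).
    rewrite /on_lattice /=; congr (_ && (_ == _)); ring.
  rewrite /lheight /= !abszN; congr (_%:R <= _).
  by rewrite [maxn `|v.1.1| _]maxnC /maxc /= [maxn `|t.1.2| _]maxnC.
move=> v; apply/idP/mapP => [|[u]].
  rewrite mem_filter => /andP[vP vm]; exists (f v); last by rewrite ff.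
  by rewrite mem_filter bf vm andbT -E ff.
by rewrite mem_filter => /andP[uP um] ->; rewrite mem_filter E uP bf.
Qed.

Lemma fibre_estimate_aux (R : realType) (n m : nat) (t : int * int * int) (Y : R) :
  (0 < n)%N -> t.1.1 != 0 -> gcd3 t = 1%N -> 0 < Y -> Y ^+ n <= m%:R ->
  `|(lattice_count n t m (Y ^+ n))%:R -
    omega_nat R n `|t.1.1| `|t.1.2| `|t.2| / 2 * Y ^+ (2 * n)| <=
  fibre_error n Y `|t.1.1| `|t.1.2| `|t.2|.
Proof.
move=> n0 a0 t1 Y0 Ym; set s := Y ^+ n; set om := omega_nat _ _ _ _ _.
have s0 : 0 < s by rewrite exprn_gt0.
have i0 : (0 < `|t.1.1|)%N by lia.
have sE : Y ^+ (2 * n) = s * s by rewrite mul2n -addnn exprD.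
rewrite /fibre_error -/(maxc t) -/s sE; set M := maxc t; set A := maxn _ _.
have A0 : (0 < A)%N by rewrite /A; lia.
have M0 : (0 < M)%N by rewrite /M /maxc; lia.
have MR : 0 < M%:R :> R by rewrite ltr0n.
have om0 : 0 <= om by apply: omega_nat_ge0.
have om8 : om / 2 * (s * s) <= 4 * (s * s) / M%:R ^+ n.+1.
  rewrite [leRHS]mulrAC ler_wpM2r ?mulr_ge0 ?(ltW s0) //.
  apply: le_trans (_ : 8 / M%:R ^+ n.+1 / 2 <= _).
    by rewrite ler_pM2r ?invr_gt0 // omega_nat_le.
  rewrite le_eqVlt; apply/orP; left; apply/eqP.
  by field; rewrite gt_eqF // exprn_gt0.
rewrite A0; case: ifPn => [MY|MY]; last first.
  rewrite -ltNge in MY.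
  have -> : lattice_count n t m s = 0%N.
    apply/eqP; rewrite -leqn0 leqNgt -has_count; apply/hasPn => v _.
    apply/negP => /andP[/andP[q0 _] hv].
    have : M%:R ^+ n <= s.
      apply: le_trans hv; rewrite -natrX ler_nat /lheight.
      by rewrite leq_max leq_pmull //; lia.
    by rewrite leNgt ltrXn2r // ?gtn_eqF // ltW.
  by rewrite sub0r normrN ger0_norm // !mulr_ge0 ?(ltW s0).
set g := gcdn _ _.
have g0 : (0 < g)%N by rewrite gcdn_gt0 i0.
(* The slices are [h] apart after rescaling the heights [q] by [s]. *)
pose h : R := g%:R / s.
have h0 : 0 < h by rewrite divr_gt0 // ltr0n.
have est := lattice_count_estimate n0 a0 t1 s0 Ym.
pose S : R := \sum_(1 <= l < m.+1) slice_density n `|t.1.1| `|t.1.2| `|t.2| (h * l%:R).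
have SE : \sum_(1 <= j < m.+1) g%:R * s *
     slice_density n `|t.1.1| `|t.1.2| `|t.2| (g%:R * j%:R / s) = s * s * (h * S).
  rewrite /S !mulr_sumr; apply: eq_bigr => l _.
  rewrite [g%:R * _ / s]mulrAC -/h !mulrA; congr (_ * _).
  by rewrite /h; field; rewrite gt_eqF.
rewrite -/s -/g SE -/M in est.
have hm x : h * m%:R < x -> slice_density n `|t.1.1| `|t.1.2| `|t.2| x = 0.
  move=> hx; apply: slice_density_eq0; rewrite -/(maxc t) -/M; apply/orP; left.
  have x1 : 1 < x.
    apply: le_lt_trans hx; rewrite /h mulrAC ler_pdivlMr // mul1r.
    by apply: le_trans Ym _; rewrite -natrM ler_nat leq_pmull.
  apply: (lt_le_trans x1); rewrite ler_peMr ?exprn_ege1 ?ler1n //.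
  by apply: ltW; apply: lt_trans x1.
have /andP[R1 _] := omega_nat_riemann i0 h0 hm.
have R2 : om <= 2 * h * (slice_density n `|t.1.1| `|t.1.2| `|t.2| 0 + S).
  have hm1 x : h * m.+1%:R < x -> slice_density n `|t.1.1| `|t.1.2| `|t.2| x = 0.
    move=> hx; apply: hm; apply: le_lt_trans hx.
    by rewrite ler_pM2l // ler_nat.
  have /andP[_] := omega_nat_riemann i0 h0 hm1.
  by rewrite big_ltn // mulr0.
rewrite -/om -/S in R1.
have R3 := slice_density_le n `|t.1.2| `|t.2| (0 : R) i0; rewrite -/A in R3.
apply: le_trans (_ : `|(lattice_count n t m s)%:R - s * s * (h * S)| +
   `|om / 2 * (s * s) - s * s * (h * S)| <= _).
  by rewrite [ `|om / 2 * _ - _|]distrC; apply: ler_distD.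
apply: lerD => //.
have ss0 : 0 < s * s by rewrite mulr_gt0.
have -> : om / 2 * (s * s) - s * s * (h * S) = s * s * (om / 2 - h * S) by ring.
rewrite ger0_norm; last by rewrite mulr_ge0 ?(ltW ss0) // subr_ge0; lra.
rewrite le_min; apply/andP; split; last first.
  apply: le_trans om8; rewrite mulrC ler_pM2r // gerBl mulr_ge0 ?(ltW h0) //.
  by apply: sumr_ge0 => l _; apply: slice_density_ge0.
apply: le_trans (_ : s * s * (h * (2 / A%:R)) <= _); last first.
  rewrite le_eqVlt; apply/orP; left; apply/eqP; rewrite /h.
  by field; rewrite !gt_eqF // ltr0n.
rewrite ler_pM2l //.
have : h * slice_density n `|t.1.1| `|t.1.2| `|t.2| 0 <= h * (2 / A%:R).
  by rewrite ler_pM2l.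
lra.
Qed.

(** If [a = 0], the roles of [a] and [c] are exchanged. *)
Lemma fibre_estimate (R : realType) (n m : nat) (t : int * int * int) (Y : R) :
  (0 < n)%N -> (t.1.1 != 0) || (t.1.2 != 0) -> gcd3 t = 1%N -> 0 < Y ->
  Y ^+ n <= m%:R ->
  `|(lattice_count n t m (Y ^+ n))%:R - omega_pt R n t / 2 * Y ^+ (2 * n)| <=
  fibre_error n Y `|t.1.1| `|t.1.2| `|t.2|.
Proof.
move=> n0 ac t1 Y0 Ym; rewrite /omega_pt; case: ifPn => [a0|a0].
  exact: fibre_estimate_aux.
have c0 : (swap_pt t).1.1 != 0 by move: ac; rewrite (negbTE a0).
have s1 : gcd3 (swap_pt t) = 1%N by rewrite -t1 /gcd3 /= [gcdn `|t.1.2| _]gcdnC.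
have := fibre_estimate_aux n0 c0 s1 Y0 Ym; rewrite lattice_count_swap /=.
by rewrite /fibre_error [maxn `|t.1.2| _]maxnC [gcdn `|t.1.2| _]gcdnC.
Qed.

(** * Summation over the fibres *)

(** One of the two coprime integral coordinate vectors of each point of the
plane outside [a = c = 0]. *)
Definition normalized (t : int * int * int) : bool :=
  (gcd3 t == 1%N) && ((0 < t.1.1) || (t.1.1 == 0) && (0 < t.1.2)).

Lemma normalized_neq0 (t : int * int * int) :
  normalized t -> (t.1.1 != 0) || (t.1.2 != 0).
Proof. by case/andP=> _; lia. Qed.

Lemma fibre_error_ge0 (R : realType) (n i j k : nat) (Y : R) : 0 < Y ->
  0 <= fibre_error n Y i j k.
Proof.
move=> Y0; have Y1 := ltW Y0; rewrite /fibre_error; case: ifP => // _.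
case: ifP => _; last by rewrite divr_ge0 ?mulr_ge0 ?exprn_ge0.
rewrite addr_ge0 ?divr_ge0 ?exprn_ge0 //.
by rewrite le_min !divr_ge0 ?mulr_ge0 ?exprn_ge0.
Qed.

Definition error_constant (R : realType) (n : nat) : R :=
  864 + 128 * n.+1%:R * n.+2%:R.

Lemma error_constant_ge0 (R : realType) (n : nat) : 0 <= error_constant R n.
Proof. by rewrite /error_constant addr_ge0 ?ler0n // !mulr_ge0 ?ler0n. Qed.

(** This holds for all [Y > 0], in particular when there is no lattice point at all, so
that it can be summed over all [k] with [Y / k ^ (1 / n)] in place of [Y]. *)
Lemma lattice_sum_estimate (R : realType) (n m p : nat) (Y : R) :
  (3 <= n)%N -> 0 < Y -> Y ^+ n <= m%:R ->
  `|\sum_(t <- box3 p | normalized t) ((lattice_count n t m (Y ^+ n))%:R -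
      omega_pt R n t / 2 * Y ^+ (2 * n))| <= error_constant R n * Y ^+ n.+2.
Proof.
move=> n3 Y0 Ym; apply: le_trans (ler_norm_sum _ _ _) _.
apply: le_trans (fibre_error_sum_le p n3 Y0).
rewrite big_mkcond; apply: ler_sum => t _; case: ifPn => tJ.
  apply: fibre_estimate; rewrite ?normalized_neq0 //; first by lia.
  by case/andP: tJ => /eqP.
exact: fibre_error_ge0.
Qed.

(** Summed over [k], the errors [(Y / k ^ (1 / n)) ^ (n + 2)] are a constant times
[Y ^ (n + 2)] because the exponent of [k] is [- 1 - 2 / n]. *)
Lemma primitive_sum_moebius (R : realType) (n m p N : nat) (Y : R) :
  (3 <= n)%N -> 0 < Y -> Y ^+ n <= m%:R -> Y ^+ n <= N%:R ->
  `|\sum_(t <- box3 p | normalized t) (primitive_count n t m (Y ^+ n))%:R -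
    (\sum_(1 <= k < N.+1) (moebius k)%:~R / k%:R ^+ 2) *
    ((\sum_(t <- box3 p | normalized t) omega_pt R n t) / 2 * Y ^+ (2 * n))| <=
  error_constant R n * n.+1%:R * Y ^+ n.+2.
Proof.
move=> n3 Y0 Ym YN; have n0 : (0 < n)%N by lia.
pose Yk (k : nat) : R := Y / nroot R n k.
have YkE (k : nat) : (0 < k)%N -> Yk k ^+ n = Y ^+ n / k%:R.
  by move=> k0; rewrite /Yk expr_div_n nrootX.
have -> : \sum_(t <- box3 p | normalized t) (primitive_count n t m (Y ^+ n))%:R -
    (\sum_(1 <= k < N.+1) (moebius k)%:~R / k%:R ^+ 2) *
    ((\sum_(t <- box3 p | normalized t) omega_pt R n t) / 2 * Y ^+ (2 * n)) =
  \sum_(1 <= k < N.+1) (moebius k)%:~R *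
    \sum_(t <- box3 p | normalized t) ((lattice_count n t m (Yk k ^+ n))%:R -
      omega_pt R n t / 2 * Yk k ^+ (2 * n)).
  transitivity (\sum_(t <- box3 p | normalized t) \sum_(1 <= k < N.+1)
     ((moebius k)%:~R * (lattice_count n t m (Yk k ^+ n))%:R : R) -
    \sum_(1 <= k < N.+1) (moebius k)%:~R *
    \sum_(t <- box3 p | normalized t) (omega_pt R n t / 2 * Yk k ^+ (2 * n))).
    congr (_ - _).
      apply: eq_bigr => t tJ; have ac := normalized_neq0 tJ.
      have M0 : (0 < maxc t)%N by rewrite /maxc; lia.
      rewrite -[LHS]/((primitive_count n t m (Y ^+ n))%:Z%:~R).
      rewrite (primitive_countE n M0 Ym YN) rmorph_sum /= big_nat [RHS]big_nat.
      by apply: eq_bigr => k /andP[k0 _]; rewrite intrM YkE.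
    rewrite mulr_suml big_nat [RHS]big_nat; apply: eq_bigr => k /andP[k0 _].
    rewrite -!mulrA; congr (_ * _); rewrite mulrCA mulr_suml.
    apply: eq_bigr => t _; rewrite [(2 * n)%N]mulnC !exprM YkE // expr_div_n.
    by ring.
  rewrite exchange_big /= -sumrB; apply: eq_bigr => k _.
  by rewrite -mulr_sumr -mulrBr -sumrB.
apply: le_trans (ler_norm_sum _ _ _) _.
apply: le_trans (_ : \sum_(1 <= k < N.+1) error_constant R n * Y ^+ n.+2 *
   (k%:R * nroot R n k)^-1 <= _); last first.
  rewrite -mulr_sumr [leRHS]mulrAC ler_wpM2l ?sum_invr_nroot //.
  by apply: mulr_ge0; [exact: error_constant_ge0|exact/exprn_ge0/ltW].
rewrite big_nat [leRHS]big_nat; apply: ler_sum => k /andP[k0 _].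
have rk := nroot_gt0 R n k0; have kR : 0 < k%:R :> R by rewrite ltr0n.
have Yk0 : 0 < Yk k by rewrite divr_gt0.
have Ykm : Yk k ^+ n <= m%:R.
  rewrite YkE // ler_pdivrMr //; apply: le_trans Ym _.
  by rewrite -natrM ler_nat leq_pmulr.
rewrite normrM; apply: le_trans (_ : 1 * _ <= _).
  apply: ler_wpM2r; first exact: normr_ge0.
  by rewrite -intr_norm -[1]/(1%:~R) ler_int normr_moebius.
rewrite mul1r; apply: le_trans (lattice_sum_estimate p n3 Yk0 Ykm) _.
rewrite -mulrA ler_wpM2l ?error_constant_ge0 //.
rewrite /Yk expr_div_n ler_wpM2l ?exprn_ge0 ?(ltW Y0) //.
have rX : 0 < nroot R n k ^+ n.+2 by rewrite exprn_gt0.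
rewrite lef_pV2 ?posrE //; last by rewrite mulr_gt0.
rewrite -addn2 exprD nrootX // ler_pM2l // expr2 ler_peMl ?(ltW rk) //.
exact: nroot_ge1.
Qed.

(** The bound in [primitive_sum_moebius] does not depend on [N], which may thus be taken
so large that the truncated sum is as close to [1 / zeta 2] as desired. *)
Lemma primitive_sum_estimate (R : realType) (n m p : nat) (Y : R) :
  (3 <= n)%N -> 0 < Y -> Y ^+ n <= m%:R ->
  `|\sum_(t <- box3 p | normalized t) (primitive_count n t m (Y ^+ n))%:R -
    (zeta R 2)^-1 *
    ((\sum_(t <- box3 p | normalized t) omega_pt R n t) / 2 * Y ^+ (2 * n))| <=
  error_constant R n * n.+1%:R * Y ^+ n.+2.
Proof.
move=> n3 Y0 Ym; set P := \sum_(t <- _ | _) _; set X := _ / 2 * _.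
set E := leRHS; apply/ler_addgt0Pr => e e0.
pose N := (maxn (Num.truncn (Y ^+ n)) (Num.truncn ((6 * `|X| / e) ^+ 2))).+1.
have x0 : 0 <= 6 * `|X| / e by rewrite divr_ge0 ?mulr_ge0 // ltW.
have YN : Y ^+ n <= N%:R.
  apply: ltW; apply: lt_le_trans (truncnS_gt _) _.
  by rewrite ler_nat ltnS leq_maxl.
(* The second argument of [maxn] makes [6 |X| / N ^ (1 / 2)] at most [e]. *)
have eN : 6 / nroot R 2 N * `|X| <= e.
  have rN : 0 < nroot R 2 N by apply: nroot_gt0.
  rewrite mulrAC ler_pdivrMr // [leRHS]mulrC -ler_pdivrMr //.
  rewrite -(@ler_pXn2r _ 2) ?nnegrE ?nroot_ge0 // nrootX //.
  apply: ltW; apply: lt_le_trans (truncnS_gt _) _.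
  by rewrite ler_nat ltnS leq_maxr.
have H1 := primitive_sum_moebius p n3 Y0 Ym YN.
have H2 := @sum_moebius_zeta2 R N isT.
rewrite -/P -/X -/E in H1; set S := \sum_(1 <= k < N.+1) _ in H1 H2.
have -> : P - (zeta R 2)^-1 * X = (P - S * X) + (S - (zeta R 2)^-1) * X by ring.
apply: le_trans (ler_normD _ _) _; apply: lerD => //.
by rewrite normrM; apply: le_trans eN; apply: ler_wpM2r.
Qed.

Lemma omega_pt_ge0 (R : realType) (n : nat) (t : int * int * int) :
  0 <= omega_pt R n t.
Proof. by rewrite /omega_pt; case: ifP => _; apply: omega_nat_ge0. Qed.

Lemma omega_pt_le (R : realType) (n : nat) (t : int * int * int) :
  (t.1.1 != 0) || (t.1.2 != 0) -> omega_pt R n t <= 8 / (maxc t)%:R ^+ n.+1.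
Proof.
rewrite /omega_pt; case: ifPn => [a0 _|_ /= c0].
  by apply: omega_nat_le; lia.
by rewrite /maxc [maxn `|t.1.1| _]maxnC; apply: omega_nat_le; lia.
Qed.

Lemma omega_pt_sum_le (R : realType) (n p : nat) : (3 <= n)%N ->
  \sum_(t <- box3 p | normalized t) omega_pt R n t <= 1536.
Proof.
move=> n3; pose f (i : nat) : R := if (0 < i)%N then 8 / i%:R ^+ n.+1 else 0.
have f0 i : 0 <= f i.
  by rewrite /f; case: ifP => // _; rewrite divr_ge0 ?exprn_ge0.
apply: le_trans (_ : \sum_(t <- box3 p) f (maxc t) <= _).
  rewrite big_mkcond; apply: ler_sum => t _; case: ifPn => // tJ.
  have ac := normalized_neq0 tJ.
  by rewrite /f ifT ?omega_pt_le // /maxc; lia.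
apply: le_trans (sum_box3_maxc_le p f0 _) _; first by rewrite /f.
have -> : 1536 = 96 * (8 * 2) :> R by ring.
rewrite ler_wpM2l //; apply: le_trans (_ : 8 * \sum_(1 <= i < p.+1) i%:R ^- 2 <= _).
  rewrite mulr_sumr big_nat [leRHS]big_nat; apply: ler_sum => i /andP[i0 _].
  have iR : 0 < i%:R :> R by rewrite ltr0n.
  rewrite /f i0 -mulrA ler_wpM2l // -[leRHS]mul1r ler_pdivlMr ?exprn_gt0 // -mulrA mulrC.
  rewrite ler_pdivrMr ?exprn_gt0 // mul1r -exprD.
  by apply: ler_weXn2l; rewrite ?ler1n //; lia.
by rewrite ler_wpM2l // sum_invr_sqr.
Qed.

(** * Rational points of weighted projective spaces *)

Lemma wscaling_refl (m : nat) (w : m.-tuple nat) (x : m.-tuple rat) :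
  wscaling w x x.
Proof.
by exists 1; rewrite ?oner_neq0 // => i; rewrite expr1n mul1r.
Qed.

Lemma wscaling_sym (m : nat) (w : m.-tuple nat) (x y : m.-tuple rat) :
  wscaling w x y -> wscaling w y x.
Proof.
move=> [t t0 xy]; exists t^-1; rewrite ?invr_eq0 // => i.
by rewrite xy mulrA -exprMn mulVf // expr1n mul1r.
Qed.

Lemma wscaling_trans (m : nat) (w : m.-tuple nat) (x y z : m.-tuple rat) :
  wscaling w x y -> wscaling w y z -> wscaling w x z.
Proof.
move=> [t t0 xy] [u u0 yz]; exists (u * t); rewrite ?mulf_neq0 // => i.
by rewrite yz xy mulrA exprMn.
Qed.

Lemma wpoint_eq (m : nat) (w : m.-tuple nat) (x y : m.-tuple rat) :
  wpoint w x = wpoint w y <-> wscaling w x y.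
Proof.
split=> [e|xy].
  by have := wscaling_refl w y; rewrite -[wscaling w y y]/(wpoint w y y) -e.
apply/seteqP; split=> z /=; first by apply: wscaling_trans; apply: wscaling_sym.
exact: wscaling_trans.
Qed.

Lemma tuple3_ex (T : Type) (x : 3.-tuple T) :
  exists a c z, x = [tuple a; c; z].
Proof.
case: x => -[|a [|c [|z [|]]]] //= p; exists a, c, z; exact: val_inj.
Qed.

Lemma tuple5_ex (T : Type) (x : 5.-tuple T) :
  exists a b c d z, x = [tuple a; b; c; d; z].
Proof.
case: x => -[|a [|b [|c [|d [|z [|]]]]]] //= p.
by exists a, b, c, d, z; exact: val_inj.
Qed.

Notation plane_weights := [tuple 1%N; 1%N; 1%N].

Notation hypersurface_weights n := [tuple 1%N; n; 1%N; n; 1%N].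

(** A nonzero coordinate of weight one shows that the scaling factor is a quotient of
two rationals. *)
Lemma wscaling_planeP (a c z a' c' z' : rat) : [|| a != 0, c != 0 | z != 0] ->
  wscaling plane_weights [tuple a; c; z] [tuple a'; c'; z'] <->
  exists2 r : rat, r != 0 & [/\ a' = r * a, c' = r * c & z' = r * z].
Proof.
move=> nz; split=> [[t t0 H]|[r r0 [-> -> ->]]].
  have := (H (inord 0), H (inord 1), H (inord 2)).
  rewrite !(tnth_nth 0) ?(tnth_nth 0%N) !inordK //= !expr1 => -[[Ha Hc] Hz].
  have rational (x x' : rat) : x != 0 -> ratr x' = t * ratr x -> t = ratr (x' / x).
    by move=> x0 e; rewrite fmorph_div /= e mulfK // fmorph_eq0.
  have [r rE] : exists r : rat, t = ratr r.
    case/or3P: nz => x0; [have := rational _ _ x0 Ha|have := rational _ _ x0 Hc|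
      have := rational _ _ x0 Hz] => ->; by eexists.
  move: t0 Ha Hc Hz; rewrite {}rE fmorph_eq0 -!rmorphM => r0.
  by move=> /fmorph_inj Ha /fmorph_inj Hc /fmorph_inj Hz; exists r.
exists (ratr r); rewrite ?fmorph_eq0 // => i; rewrite !(tnth_nth 0) ?(tnth_nth 0%N).
by case: i => -[|[|[|]]] //= _; rewrite rmorphM expr1.
Qed.

Lemma wscaling_hypersurfaceP (n : nat) (a b c d z a' b' c' d' z' : rat) :
  [|| a != 0, c != 0 | z != 0] ->
  wscaling (hypersurface_weights n) [tuple a; b; c; d; z] [tuple a'; b'; c'; d'; z']
  <-> exists2 r : rat, r != 0 &
    [/\ a' = r * a, b' = r ^+ n * b, c' = r * c, d' = r ^+ n * d & z' = r * z].
Proof.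
move=> nz; split=> [[t t0 H]|[r r0 [-> -> -> -> ->]]].
  have := (H (inord 0), H (inord 1), H (inord 2), H (inord 3), H (inord 4)).
  rewrite !(tnth_nth 0) ?(tnth_nth 0%N) !inordK //= !expr1.
  move=> -[[[[Ha Hb] Hc] Hd] Hz].
  have rational (x x' : rat) : x != 0 -> ratr x' = t * ratr x -> t = ratr (x' / x).
    by move=> x0 e; rewrite fmorph_div /= e mulfK // fmorph_eq0.
  have [r rE] : exists r : rat, t = ratr r.
    case/or3P: nz => x0; [have := rational _ _ x0 Ha|have := rational _ _ x0 Hc|
      have := rational _ _ x0 Hz] => ->; by eexists.
  move: t0 Ha Hb Hc Hd Hz; rewrite {}rE fmorph_eq0 -!rmorphXn -!rmorphM => r0.
  move=> /fmorph_inj Ha /fmorph_inj Hb /fmorph_inj Hc /fmorph_inj Hd /fmorph_inj Hz.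
  by exists r.
exists (ratr r); rewrite ?fmorph_eq0 // => i; rewrite !(tnth_nth 0) ?(tnth_nth 0%N).
by case: i => -[|[|[|[|[|]]]]] //= _; rewrite rmorphM ?rmorphXn /= ?expr1.
Qed.

(** * Primitive integral vectors *)

Lemma Bezout3 (t : int * int * int) : gcd3 t = 1%N ->
  exists x y w : int, x * t.1.1 + y * t.1.2 + w * t.2 = 1.
Proof.
move=> t1; have [u [v uv]] := Bezoutz t.1.1 t.1.2.
have [x [y xy]] := Bezoutz (gcdz t.1.1 t.1.2) t.2.
exists (x * u), (x * v), y.
have -> : x * u * t.1.1 + x * v * t.1.2 + y * t.2 =
   x * (u * t.1.1 + v * t.1.2) + y * t.2 by ring.
by rewrite uv xy /gcdz absz_nat -/(gcd3 t) t1.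
Qed.

(** By Bezout, the ratio is an integral combination of the coordinates of [t']. *)
Lemma primitive_ratio_int (t t' : int * int * int) (r : rat) : gcd3 t = 1%N ->
  t'.1.1%:~R = r * t.1.1%:~R -> t'.1.2%:~R = r * t.1.2%:~R ->
  t'.2%:~R = r * t.2%:~R -> exists k : int, r = k%:~R.
Proof.
move=> /Bezout3[x [y [w e]]] h1 h2 h3.
exists (x * t'.1.1 + y * t'.1.2 + w * t'.2).
have <- : r * (x * t.1.1 + y * t.1.2 + w * t.2)%:~R = r by rewrite e mulr1.
by rewrite !intrD !intrM h1 h2 h3; ring.
Qed.

Lemma primitive_ratio (t t' : int * int * int) (r : rat) :
  gcd3 t = 1%N -> gcd3 t' = 1%N ->
  t'.1.1%:~R = r * t.1.1%:~R -> t'.1.2%:~R = r * t.1.2%:~R ->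
  t'.2%:~R = r * t.2%:~R -> r = 1 \/ r = - 1.
Proof.
move=> t1 t1' h1 h2 h3.
have [k kE] := primitive_ratio_int t1 h1 h2 h3.
have int_eq (x y : int) : x%:~R = r * y%:~R -> x = k * y.
  by rewrite kE -intrM => /intr_inj.
have : gcd3 t' = (`|k| * gcd3 t)%N.
  by rewrite /gcd3 (int_eq _ _ h1) (int_eq _ _ h2) (int_eq _ _ h3) !abszM -!muln_gcdr.
rewrite t1 t1' muln1 => k1.
have [k1'|k1'] : k = 1 \/ k = - 1 by lia.
  by left; rewrite kE k1'.
by right; rewrite kE k1'.
Qed.

Lemma primitive_part (v : int * int * int) : (0 < gcd3 v)%N ->
  exists2 u, gcd3 u = 1%N & v = scale3 (gcd3 v) u.
Proof.
move=> v0; have [u vE] := dvdn_gcd3_scale (dvdnn (gcd3 v)); exists u => //.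
have := gcd3_scale (gcd3 v) u; rewrite -vE => /eqP.
by rewrite -{1}[gcd3 v]muln1 eqn_pmul2l // => /eqP.
Qed.

Lemma primitive_coords (x y w : rat) : [|| x != 0, y != 0 | w != 0] ->
  exists u : int * int * int, gcd3 u = 1%N /\ exists2 r : rat, 0 < r &
    [/\ x = r * u.1.1%:~R, y = r * u.1.2%:~R & w = r * u.2%:~R].
Proof.
move=> nz; pose D : int := denq x * denq y * denq w.
have D0 : 0 < D by rewrite !mulr_gt0.
have DR : D%:~R != 0 :> rat by rewrite intr_eq0 gt_eqF.
pose v : int * int * int := ((numq x * (denq y * denq w),
   numq y * (denq x * denq w)), numq w * (denq x * denq y)).
have dE (e : rat) : (denq e)%:~R != 0 :> rat by rewrite intr_eq0 denq_neq0.
have xE : x * D%:~R = v.1.1%:~R.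
  by rewrite -{1}[x]divq_num_den /D /= !intrM; field; rewrite !dE.
have yE : y * D%:~R = v.1.2%:~R.
  by rewrite -{1}[y]divq_num_den /D /= !intrM; field; rewrite !dE.
have wE : w * D%:~R = v.2%:~R.
  by rewrite -{1}[w]divq_num_den /D /= !intrM; field; rewrite !dE.
have v0 : (0 < gcd3 v)%N.
  have nz_absz (e : rat) (k : int) : e != 0 -> e * D%:~R = k%:~R -> (0 < `|k|)%N.
    move=> e0 ek; rewrite absz_gt0 -(intr_eq0 rat) -ek.
    by rewrite mulf_neq0.
  rewrite /gcd3 !gcdn_gt0; case/or3P: nz => e0.
  - by rewrite (nz_absz _ _ e0 xE).
  - by rewrite (nz_absz _ _ e0 yE) orbT.
  - by rewrite (nz_absz _ _ e0 wE) orbT.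
clearbody D; have [u u1 vE] := primitive_part v0; set g := gcd3 v in v0 vE.
exists u; split=> //; exists (g%:R / D%:~R).
  by rewrite divr_gt0 ?ltr0n // ltr0z.
move: xE yE wE; rewrite vE /scale3 /= !intrM => xE yE wE.
have gE : g%:Z%:~R = g%:R :> rat by [].
by split; apply: (mulIf DR); rewrite ?xE ?yE ?wE gE; field.
Qed.

Definition plane_pt (t : int * int * int) : set (3.-tuple rat) :=
  wpoint plane_weights [tuple t.1.1%:~R; t.1.2%:~R; t.2%:~R].

Lemma normalized_ratio (t t' : int * int * int) (r : rat) :
  normalized t -> normalized t' ->
  t'.1.1%:~R = r * t.1.1%:~R -> t'.1.2%:~R = r * t.1.2%:~R ->
  t'.2%:~R = r * t.2%:~R -> r = 1.
Proof.
move=> /andP[/eqP t1 s] /andP[/eqP t1' s'] h1 h2 h3.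
have [//|rE] := primitive_ratio t1 t1' h1 h2 h3.
have int_eq (x y : int) : x%:~R = r * y%:~R -> x = - y.
  by rewrite rE mulN1r -mulrNz => /intr_inj.
by move: (int_eq _ _ h1) (int_eq _ _ h2); move: s s'; lia.
Qed.

Lemma rational_inj3 (t t' : int * int * int) :
  t'.1.1%:~R = t.1.1%:~R :> rat -> t'.1.2%:~R = t.1.2%:~R :> rat ->
  t'.2%:~R = t.2%:~R :> rat -> t = t'.
Proof.
by case: t t' => [[a c] z] [[a' c'] z'] /= /intr_inj -> /intr_inj -> /intr_inj ->.
Qed.

Lemma normalized_rat_neq0 (t : int * int * int) : normalized t ->
  [|| t.1.1%:~R != 0 :> rat, t.1.2%:~R != 0 :> rat | t.2%:~R != 0 :> rat].
Proof.
by move=> /normalized_neq0 /orP[] t0; rewrite !intr_eq0 t0 ?orbT.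
Qed.

Lemma plane_pt_inj (t t' : int * int * int) : normalized t -> normalized t' ->
  plane_pt t = plane_pt t' -> t = t'.
Proof.
move=> Jt Jt' /wpoint_eq /(wscaling_planeP _ _ _ (normalized_rat_neq0 Jt)).
move=> [r r0 [h1 h2 h3]]; have r1 := normalized_ratio Jt Jt' h1 h2 h3.
by move: h1 h2 h3; rewrite r1 !mul1r; apply: rational_inj3.
Qed.

Lemma normalized_coords (a c z : rat) : (a != 0) || (c != 0) ->
  exists2 t, normalized t & exists2 r : rat, r != 0 &
    [/\ a = r * t.1.1%:~R, c = r * t.1.2%:~R & z = r * t.2%:~R].
Proof.
move=> ac; have nz : [|| a != 0, c != 0 | z != 0] by rewrite orbA ac.
have [u [u1 [r r0 [aE cE zE]]]] := primitive_coords nz.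
have u0 : (u.1.1 != 0) || (u.1.2 != 0).
  apply: contraTT ac; rewrite !negb_or !negbK aE cE => /andP[/eqP-> /eqP->].
  by rewrite mulr0 eqxx.
case: (boolP ((0 < u.1.1) || (u.1.1 == 0) && (0 < u.1.2))) => s.
  by exists u; [rewrite /normalized u1 s|exists r; rewrite ?gt_eqF].
exists ((- u.1.1, - u.1.2), - u.2).
  by rewrite /normalized /gcd3 /= !abszN -/(gcd3 u) u1 /=; lia.
by exists (- r); rewrite ?oppr_eq0 ?gt_eqF // !mulrNz !mulrNN.
Qed.

Lemma plane_pt_bij : set_bij [set t | normalized t] P2_minus plane_pt.
Proof.
split.
- move=> t Jt; split.
    exists [tuple t.1.1%:~R; t.1.2%:~R; t.2%:~R] => //.
    case/normalized_neq0/orP: Jt => t0; [exists (inord 0)|exists (inord 1)];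
      by rewrite (tnth_nth 0) inordK //= intr_eq0.
  move=> H; have [] := H _ _ _ (wscaling_refl plane_weights _).
  move=> /eqP; rewrite intr_eq0 => /eqP a0 /eqP; rewrite intr_eq0 => /eqP c0.
  by move/normalized_neq0: Jt; rewrite a0 c0 eqxx.
- move=> t t'; rewrite !inE /= => Jt Jt'; exact: plane_pt_inj.
move=> x [[y]]; have [a [c [z ->]]] := tuple3_ex y => -[i i0] <- nac.
have nz : [|| a != 0, c != 0 | z != 0].
  move: i0; rewrite (tnth_nth 0).
  by case: i => -[|[|[|]]] //= _ ->; rewrite ?orbT.
have ac : (a != 0) || (c != 0).
  rewrite -negb_and; apply/negP => /andP[/eqP a0 /eqP c0]; apply: nac.
  move=> a' c' z' /(wscaling_planeP _ _ _ nz)[r _ [-> -> _]].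
  by rewrite a0 c0 mulr0.
have [t Jt [r r0 [aE cE zE]]] := normalized_coords z ac.
exists t => //; apply/wpoint_eq/wscaling_planeP; first exact: normalized_rat_neq0.
by exists r.
Qed.

(** Hence functions of the absolute values of coprime coordinates, such as the
integrals in question, are functions of the point. *)
Lemma coprime_coords_normalized (t : int * int * int) (a c z : int) :
  normalized t -> coprime_coords (plane_pt t) a c z ->
  [/\ `|a|%N = `|t.1.1|%N, `|c|%N = `|t.1.2|%N & `|z|%N = `|t.2|%N].
Proof.
move=> Jt [/(wscaling_planeP _ _ _ (normalized_rat_neq0 Jt))[r _ [h1 h2 h3]] cop].
have t1 : gcd3 t = 1%N by case/andP: Jt => /eqP.
have t1' : gcd3 ((a, c), z) = 1%N.
  by apply/eqP; rewrite /gcd3 /= -gcdnA -eqz_nat; apply/eqP.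
have [rE|rE] := primitive_ratio (t' := ((a, c), z)) t1 t1' h1 h2 h3;
  move: h1 h2 h3; rewrite rE ?mul1r ?mulN1r -?mulrNz.
  by move=> /intr_inj -> /intr_inj -> /intr_inj ->.
by move=> /intr_inj -> /intr_inj -> /intr_inj ->; rewrite !abszN.
Qed.

(** * The smooth points of the hypersurface *)

(** With [t = (a, c, z)] and [v = (b, d, q)], the point of [X_n] with coordinates
[(a : b / q : c : d / q : z)]. *)
Definition fibre_pt (n : nat) (t v : int * int * int) : set (5.-tuple rat) :=
  wpoint (hypersurface_weights n)
    [tuple t.1.1%:~R; v.1.1%:~R / v.2%:~R; t.1.2%:~R; v.1.2%:~R / v.2%:~R; t.2%:~R].

(** The pairs that parametrize the smooth points, each exactly once: see
[fibre_pt_inj], [fibre_pt_reg] and [Xn_regP]. *)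
Definition fibre_data (n : nat) (tv : (int * int * int) * (int * int * int)) : bool :=
  [&& normalized tv.1, on_lattice n tv.1 tv.2 & gcd3 tv.2 == 1%N].

Lemma fibre_pt_inj (n : nat) (tv tv' : (int * int * int) * (int * int * int)) :
  fibre_data n tv -> fibre_data n tv' ->
  fibre_pt n tv.1 tv.2 = fibre_pt n tv'.1 tv'.2 -> tv = tv'.
Proof.
case: tv tv' => [t v] [t' v'] /and3P[/= Jt /andP[q0 _] /eqP v1].
move=> /and3P[/= Jt' /andP[q0' _] /eqP v1'] /wpoint_eq.
move=> /(wscaling_hypersurfaceP _ _ _ _ _ _ _ _ (normalized_rat_neq0 Jt)).
move=> [r _ [h1 hb h2 hd h3]].
have r1 := normalized_ratio Jt Jt' h1 h2 h3.
move: h1 h2 h3 hb hd; rewrite r1 expr1n !mul1r => h1 h2 h3 hb hd.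
have qR : v.2%:~R != 0 :> rat by rewrite intr_eq0 gt_eqF.
have qR' : v'.2%:~R != 0 :> rat by rewrite intr_eq0 gt_eqF.
rewrite (rational_inj3 h1 h2 h3); congr (_, _).
have e1 : v'.1.1%:~R = v'.2%:~R / v.2%:~R * v.1.1%:~R :> rat.
  by rewrite -mulrA [_^-1 * _]mulrC -hb mulrC divfK.
have e2 : v'.1.2%:~R = v'.2%:~R / v.2%:~R * v.1.2%:~R :> rat.
  by rewrite -mulrA [_^-1 * _]mulrC -hd mulrC divfK.
have e3 : v'.2%:~R = v'.2%:~R / v.2%:~R * v.2%:~R :> rat by rewrite divfK.
have [rE|rE] := primitive_ratio v1 v1' e1 e2 e3.
  by move: e1 e2 e3; rewrite rE !mul1r; apply: rational_inj3.
have : v'.2%:~R / v.2%:~R > 0 :> rat by rewrite divr_gt0 // ltr0z.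
by rewrite rE oppr_gt0 ltr10.
Qed.

Lemma equation_scale (n : nat) (a b c d z r : rat) :
  (r * a) * (r ^+ n * d) - (r ^+ n * b) * (r * c) - (r * z) ^+ n.+1 =
  r ^+ n.+1 * (a * d - b * c - z ^+ n.+1).
Proof. by rewrite exprMn exprS; ring. Qed.

Lemma on_latticeE (n : nat) (t v : int * int * int) : 0 < v.2 ->
  on_lattice n t v <->
  t.1.1%:~R * (v.1.2%:~R / v.2%:~R) - v.1.1%:~R / v.2%:~R * t.1.2%:~R -
    t.2%:~R ^+ n.+1 = 0 :> rat.
Proof.
move=> q0; have qR : v.2%:~R != 0 :> rat by rewrite intr_eq0 gt_eqF.
rewrite /on_lattice q0 /= -(inj_eq (@intr_inj rat)) intrB !intrM rmorphXn /=.
have -> : t.1.1%:~R * (v.1.2%:~R / v.2%:~R) - v.1.1%:~R / v.2%:~R * t.1.2%:~R -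
    t.2%:~R ^+ n.+1 = (t.1.1%:~R * v.1.2%:~R - t.1.2%:~R * v.1.1%:~R -
    v.2%:~R * t.2%:~R ^+ n.+1) / v.2%:~R :> rat by field.
split=> [/eqP ->|/eqP]; first by rewrite subrr mul0r.
by rewrite mulf_eq0 invr_eq0 (negbTE qR) orbF subr_eq0.
Qed.

Lemma fibre_pt_reg (n : nat) (tv : (int * int * int) * (int * int * int)) :
  fibre_data n tv -> Xn_reg n (fibre_pt n tv.1 tv.2).
Proof.
case: tv => t v /and3P[/= Jt tv _].
have q0 : 0 < v.2 by case/andP: tv.
have nz := normalized_rat_neq0 Jt.
split; last first.
  move=> [_ /(_ _ _ _ _ _ (wscaling_refl _ _))[/eqP + /eqP + _]].
  by rewrite !intr_eq0 => /eqP a0 /eqP c0; move/normalized_neq0: Jt; rewrite a0 c0.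
split.
  eexists; last by reflexivity.
  case/normalized_neq0/orP: Jt => t0; [exists (inord 0)|exists (inord 2)];
    by rewrite (tnth_nth 0) inordK //= intr_eq0.
move=> a b c d z /(wscaling_hypersurfaceP _ _ _ _ _ _ _ _ nz)[r _ [-> -> -> -> ->]].
by rewrite equation_scale; move/(on_latticeE _ _ q0): tv => ->; rewrite mulr0.
Qed.

(** If [a = c = 0], the equation forces [z = 0]; so smooth points lie over the plane
minus [a = c = 0]. After scaling [(a, c, z)] to a normalized vector, [v] is the
primitive multiple of [(b, d, 1)]. *)
Lemma Xn_regP (n : nat) (x : set (5.-tuple rat)) : (0 < n)%N -> Xn_reg n x ->
  exists2 tv, fibre_data n tv & x = fibre_pt n tv.1 tv.2.
Proof.
move=> n0 [Xx nsing]; case: (Xx) => -[y _]; have [a [b [c [d [z ->]]]]] := tuple5_ex y.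
move=> yx eqn; rewrite -{}yx in Xx nsing eqn *.
have eq0 := eqn _ _ _ _ _ (wscaling_refl _ _).
have nz : [|| a != 0, c != 0 | z != 0].
  apply: contra_notT nsing; rewrite !negb_or !negbK => /and3P[/eqP a0 /eqP c0 /eqP z0].
  split=> // a' b' c' d' z' [t t0 H]; have := (H (inord 0), H (inord 2), H (inord 4)).
  rewrite !(tnth_nth 0) ?(tnth_nth 0%N) !inordK //= a0 c0 z0 rmorph0 !mulr0.
  move=> -[[/eqP + /eqP +] /eqP]; rewrite !fmorph_eq0.
  by move=> /eqP -> /eqP -> /eqP ->.
have ac : (a != 0) || (c != 0).
  apply: contraT; rewrite negb_or !negbK => /andP[/eqP a0 /eqP c0].
  move: eq0 nz; rewrite a0 c0 mul0r mulr0 subrr sub0r => /eqP.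
  by rewrite oppr_eq0 expf_eq0 /= => /eqP ->; rewrite eqxx.
have [t Jt [r r0 [aE cE zE]]] := normalized_coords z ac.
pose b1 := b / r ^+ n; pose d1 := d / r ^+ n.
have rn0 : r ^+ n != 0 by rewrite expf_neq0.
have bE : b = r ^+ n * b1 by rewrite /b1 mulrC divfK.
have dE : d = r ^+ n * d1 by rewrite /d1 mulrC divfK.
have nz1 : [|| b1 != 0, d1 != 0 | (1 : rat) != 0] by rewrite oner_neq0 !orbT.
have [v [v1 [l l0 [b1E d1E qE]]]] := primitive_coords nz1.
have q0 : 0 < v.2.
  by rewrite -(ltr0z rat) -(pmulr_rgt0 _ l0) -qE ltr01.
have qR : v.2%:~R != 0 :> rat by rewrite intr_eq0 gt_eqF.
have lE : l = v.2%:~R^-1 by apply: (mulIf qR); rewrite -qE mulVf.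
have b1E' : b1 = v.1.1%:~R / v.2%:~R by rewrite b1E lE mulrC.
have d1E' : d1 = v.1.2%:~R / v.2%:~R by rewrite d1E lE mulrC.
have eq1 : t.1.1%:~R * d1 - b1 * t.1.2%:~R - t.2%:~R ^+ n.+1 = 0 :> rat.
  have /eqP := eq0; rewrite aE bE cE dE zE equation_scale.
  by rewrite mulf_eq0 (negbTE (expf_neq0 _ r0)) => /eqP.
exists (t, v) => /=.
  rewrite /fibre_data /= Jt v1 eqxx andbT; apply/(on_latticeE _ _ q0).
  by rewrite -b1E' -d1E'.
apply/esym/wpoint_eq/wscaling_hypersurfaceP; first exact: normalized_rat_neq0.
by exists r => //; rewrite -b1E' -d1E'; split.
Qed.

(** * The height *)

Lemma maxz_nat (p q : nat) : Num.max p%:Z q%:Z = (maxn p q)%:Z.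
Proof. by case: (leP p%:Z q%:Z); lia. Qed.

Lemma expn_maxn (n p q : nat) : (maxn p q ^ n = maxn (p ^ n) (q ^ n))%N.
Proof.
case: n => [|n]; first by rewrite !expn0.
have [pq|qp] := leqP p q; first by apply/esym/maxn_idPr; rewrite leq_exp2r.
by apply/esym/maxn_idPl; rewrite leq_exp2r // ltnW.
Qed.

(** All integral coordinates of the point are obtained from [t] and [v] by an integral
factor [k]. Multiplication by [q] turns the maximum into [|k| ^ n] times the height
of [v] and the greatest common divisor into [|k| ^ n], since no prime divides both
[b], [d], [q], or [a], [c], [z]. *)
Lemma height_coords_scaled (R : realType) (n : nat)
    (t v u : int * int * int) (b d k : int) :
  (0 < n)%N -> gcd3 t = 1%N -> gcd3 v = 1%N -> 0 < v.2 -> k != 0 ->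
  u.1.1 = k * t.1.1 -> u.1.2 = k * t.1.2 -> u.2 = k * t.2 ->
  v.2 * b = k ^+ n * v.1.1 -> v.2 * d = k ^+ n * v.1.2 ->
  height_coords R n u.1.1 b u.1.2 d u.2 =
  (lheight n t v)%:R `^ (n.+2%:R / n%:R).
Proof.
move=> n0 t1 v1 q0 k0 h1 h2 h3 hb hd; rewrite /height_coords; congr (_ `^ _).
set q := `|v.2|%N; set K := (`|k| ^ n)%N.
have q1 : (0 < q)%N by rewrite /q; lia.
have K1 : (0 < K)%N by rewrite expn_gt0; lia.
pose mx := maxn (`|u.1.1| ^ n) (maxn `|b| (maxn (`|u.1.2| ^ n)
   (maxn `|d| (`|u.2| ^ n)))).
pose gg := gcdn (`|u.1.1| ^ n) (gcdn `|b| (gcdn (`|u.1.2| ^ n)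
   (gcdn `|d| (`|u.2| ^ n)))).
have -> : Num.max `|u.1.1 ^+ n| (Num.max `|b| (Num.max `|u.1.2 ^+ n|
   (Num.max `|d| `|u.2 ^+ n|))) = mx%:Z.
  by rewrite -!abszE !abszX !maxz_nat.
have -> : gcdz (u.1.1 ^+ n) (gcdz b (gcdz (u.1.2 ^+ n) (gcdz d (u.2 ^+ n)))) = gg%:Z.
  by rewrite /gcdz !absz_nat !abszX.
have hb' : (q * `|b| = K * `|v.1.1|)%N by rewrite -!abszM hb abszM abszX.
have hd' : (q * `|d| = K * `|v.1.2|)%N by rewrite -!abszM hd abszM abszX.
have hx (x y : int) : x = k * y -> (q * `|x| ^ n = K * (q * `|y| ^ n))%N.
  by move=> ->; rewrite abszM expnMn mulnCA.
have mxE : (q * mx = K * lheight n t v)%N.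
  rewrite /mx !maxnMr (hx _ _ h1) (hx _ _ h2) (hx _ _ h3) hb' hd' -!maxnMr.
  congr (_ * _)%N; rewrite /lheight -/q /maxc !expn_maxn !maxnMr.
  by rewrite -!maxnA; congr maxn; rewrite maxnCA; congr maxn; rewrite maxnA maxnC.
have ggE : (q * gg = K)%N.
  rewrite /gg !muln_gcdr (hx _ _ h1) (hx _ _ h2) (hx _ _ h3) hb' hd' -!muln_gcdr.
  rewrite -[RHS]muln1; congr (_ * _)%N; set G := gcdn _ _.
  have nodiv p : prime p -> ~~ (p %| G)%N.
    move=> pp; rewrite /G !dvdn_gcd; apply/negP => /and5P[pa pb pc pd pz].
    have [pq|npq] := boolP (p %| q)%N.
      have : (p %| gcd3 v)%N by rewrite /gcd3 !dvdn_gcd pb pd pq.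
      by rewrite v1 dvdn1 gtn_eqF // prime_gt1.
    move: pa pc pz; rewrite !Euclid_dvdM // (negbTE npq) /= !Euclid_dvdX // n0 !andbT.
    move=> pa pc pz; have : (p %| gcd3 t)%N by rewrite /gcd3 !dvdn_gcd pa pc pz.
    by rewrite t1 dvdn1 gtn_eqF // prime_gt1.
  case: (posnP G) => [G0|G0]; first by have := nodiv 2 isT; rewrite G0 dvdn0.
  apply/eqP; apply: contraT => G1; have G2 : (1 < G)%N by lia.
  by have := nodiv _ (pdiv_prime G2); rewrite pdiv_dvd.
have qR : q%:R != 0 :> R by rewrite pnatr_eq0 -lt0n.
have gR : gg%:R != 0 :> R.
  by rewrite pnatr_eq0 -lt0n; move: K1; rewrite -ggE muln_gt0 => /andP[].
rewrite -[mx%:Z%:~R]/(mx%:R) -[gg%:Z%:~R]/(gg%:R); apply: (mulfI qR).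
rewrite mulrA -natrM mxE -ggE !natrM; field; exact: gR.
Qed.

Lemma height_fibre_pt (R : realType) (n : nat)
    (tv : (int * int * int) * (int * int * int)) : (0 < n)%N -> fibre_data n tv ->
  height R n (fibre_pt n tv.1 tv.2) =
  (lheight n tv.1 tv.2)%:R `^ (n.+2%:R / n%:R).
Proof.
case: tv => t v n0 /and3P[/= Jt /andP[q0 _] /eqP v1].
have t1 : gcd3 t = 1%N by case/andP: Jt => /eqP.
have nz := normalized_rat_neq0 Jt.
have qR : v.2%:~R != 0 :> rat by rewrite intr_eq0 gt_eqF.
rewrite /height; set S := (X in get X).
have Sval h : S h -> h = (lheight n t v)%:R `^ (n.+2%:R / n%:R).
  move=> [a [b [c [d [z [/(wscaling_hypersurfaceP _ _ _ _ _ _ _ _ nz)]]]]]].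
  move=> [r r0 [aE bE cE dE zE]] ->.
  have [k kE] := primitive_ratio_int (t' := ((a, c), z)) t1 aE cE zE.
  have int_eq (x y : int) : x%:~R = r * y%:~R -> x = k * y.
    by rewrite kE -intrM => /intr_inj.
  have frac_eq (x y : int) : x%:~R = r ^+ n * (y%:~R / v.2%:~R) -> v.2 * x = k ^+ n * y.
    rewrite kE => e; apply: (@intr_inj rat); rewrite !intrM e rmorphXn /=.
    by field.
  apply: (@height_coords_scaled R n t v ((a, c), z) b d k) => //=.
  - by apply: contraNneq r0 => k0; rewrite kE k0.
  - exact: int_eq.
  - exact: int_eq.
  - exact: int_eq.
  - exact: frac_eq.
  - exact: frac_eq.
apply: Sval; apply: (@getPex _ S).
exists (height_coords R n (v.2 * t.1.1) (v.2 ^+ n.-1 * v.1.1) (v.2 * t.1.2)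
  (v.2 ^+ n.-1 * v.1.2) (v.2 * t.2)).
exists (v.2 * t.1.1), (v.2 ^+ n.-1 * v.1.1), (v.2 * t.1.2), (v.2 ^+ n.-1 * v.1.2),
  (v.2 * t.2); split=> //.
apply/(wscaling_hypersurfaceP _ _ _ _ _ _ _ _ nz); exists v.2%:~R => //.
have e : v.2%:~R ^+ n = v.2%:~R ^+ n.-1 * v.2%:~R :> rat by rewrite -exprSr prednK.
by rewrite !intrM rmorphXn /= e; split=> //; field.
Qed.

(** * Sums over the points of the plane *)

Lemma ler_sum_subset (R : realType) (T : eqType) (r s : seq T) (f : T -> R) :
  uniq r -> uniq s -> {subset r <= s} -> (forall x, x \in s -> 0 <= f x) ->
  \sum_(x <- r) f x <= \sum_(x <- s) f x.
Proof.
move=> ur us rs f0.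
have -> : \sum_(x <- r) f x = \sum_(x <- s | x \in r) f x.
  rewrite -[RHS]big_filter; apply: perm_big; apply: uniq_perm => //.
    by rewrite filter_uniq.
  move=> x; rewrite mem_filter; case xr : (x \in r) => //=.
  by rewrite rs.
rewrite [leRHS](bigID (fun x => x \in r)) /= lerDl big_seq_cond sumr_ge0 //.
by move=> x /andP[xs _]; exact: f0.
Qed.

(** Every finite set of triples lies in a box, so the infinite sum is also the supremum
of the sums over boxes, for which the estimates are available. *)
Lemma esum_box (R : realType) (P : int * int * int -> bool)
    (f : int * int * int -> R) (C : R) :
  (forall t, P t -> 0 <= f t) ->
  (forall p, \sum_(t <- box3 p | P t) f t <= C) ->
  exists S : R, [/\ (\esum_(t in [set t | P t]) (f t)%:E)%E = S%:E,
    forall p, \sum_(t <- box3 p | P t) f t <= S &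
    forall (e : R) p0, 0 < e ->
      exists2 p, (p0 <= p)%N & S - e < \sum_(t <- box3 p | P t) f t].
Proof.
move=> f0 fC; set J := [set t | P t].
have box_of (A : set (int * int * int)) (p0 : nat) : fsets J A ->
    exists2 p, (p0 <= p)%N &
      (\sum_(t \in A) (f t)%:E <= (\sum_(t <- box3 p | P t) f t)%:E)%E.
  move=> [finA AJ]; pose p := maxn p0 (\max_(t <- fset_set A) maxc t).
  exists p; first exact: leq_maxl.
  rewrite fsbig_finite //= sumEFin lee_fin -[leRHS]big_filter.
  apply: ler_sum_subset; rewrite ?fset_uniq ?filter_uniq ?box3_uniq //.
    move=> t tA; have tA' : A t by move: tA; rewrite in_fset_set // inE.
    rewrite mem_filter (AJ _ tA') mem_box3.
    have : (maxc t <= p)%N.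
      by apply: leq_trans (leq_maxr _ _); apply: leq_bigmax_seq.
    by rewrite /maxc !geq_max => /andP[/andP[-> ->] ->].
  by move=> t; rewrite mem_filter => /andP[/f0].
have boxJ p : fsets J [set` [seq t <- box3 p | P t]].
  split; first exact: finite_seq.
  move=> t tp; have : t \in [seq t <- box3 p | P t] := tp.
  by rewrite mem_filter => /andP[].
have box_le p : ((\sum_(t <- box3 p | P t) f t)%:E <= \esum_(t in J) (f t)%:E)%E.
  apply: esum_ge; exists [set` [seq t <- box3 p | P t]] => //.
  by rewrite -fsbig_seq ?filter_uniq ?box3_uniq // sumEFin big_filter.
have leC : (\esum_(t in J) (f t)%:E <= C%:E)%E.
  apply: ge_ereal_sup => _ [A /(box_of _ 0%N)[p _ Ap] <-].
  by apply: le_trans Ap _; rewrite lee_fin.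
have fin : \esum_(t in J) (f t)%:E \is a fin_num.
  rewrite ge0_fin_numE; first by apply: le_lt_trans leC _; rewrite ltry.
  by apply: esum_ge0 => t /f0; rewrite lee_fin.
exists (fine (\esum_(t in J) (f t)%:E)); split; first by rewrite fineK.
  by move=> p; rewrite -lee_fin fineK.
move=> e p0 e0; have [x [A AJ <-] Ax] := ub_ereal_sup_adherent e0 fin.
have [p pp Ap] := box_of A p0 AJ; exists p => //.
rewrite -lte_fin; apply: lt_le_trans Ap; apply: le_lt_trans Ax.
by rewrite EFinB fineK.
Qed.

(** * Counting points of bounded height *)

Definition bounded_data (R : realType) (n p m : nat) (T : R) :
    seq ((int * int * int) * (int * int * int)) :=
  [seq tv <- [seq (t, v) | t <- box3 p, v <- box3 m] |
     fibre_data n tv && ((lheight n tv.1 tv.2)%:R <= T)].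

Lemma bounded_data_uniq (R : realType) (n p m : nat) (T : R) :
  uniq (bounded_data n p m T).
Proof.
rewrite filter_uniq //; apply: allpairs_uniq; rewrite ?box3_uniq //.
by move=> [? ?] [? ?] _ _ [-> ->].
Qed.

Lemma size_bounded_data (R : realType) (n p m : nat) (T : R) :
  size (bounded_data n p m T) =
  (\sum_(t <- box3 p | normalized t) primitive_count n t m T)%N.
Proof.
rewrite /bounded_data size_filter -sum1_count big_mkcond big_allpairs /=.
rewrite [RHS]big_mkcond; apply: eq_bigr => t _; case: ifPn => Jt.
  rewrite /primitive_count -sum1_count [RHS]big_mkcond; apply: eq_bigr => v _.
  by rewrite /fibre_data /= Jt /= -andbA [(_ == _) && _]andbC.
by rewrite big1 // => v _; rewrite /fibre_data /= (negbTE Jt).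
Qed.

Lemma mem_bounded_data (R : realType) (n m p : nat) (T : R)
    (tv : (int * int * int) * (int * int * int)) :
  (0 < n)%N -> T <= m%:R -> (m <= p)%N ->
  (tv \in bounded_data n p m T) =
  fibre_data n tv && ((lheight n tv.1 tv.2)%:R <= T).
Proof.
move=> n0 Tm mp; rewrite mem_filter; apply/andP/idP => [[]//|H]; split=> //.
case: tv H => t v /andP[/and3P[Jt /andP[q0 _] _] hT].
rewrite /= in Jt q0 hT.
have M0 : (0 < maxc t)%N by have := normalized_neq0 Jt; rewrite /maxc; lia.
have hm : (lheight n t v <= m)%N by rewrite -(ler_nat R); apply: le_trans Tm.
apply: (allpairs_f pair); last exact: lheight_le_box hm.
have : (maxc t <= p)%N.
  apply: leq_trans mp; apply: leq_trans hm; rewrite /lheight leq_max.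
  apply/orP; left; apply: leq_trans (_ : maxc t ^ n <= _)%N.
    by rewrite -{1}[maxc t]expn1 leq_pexp2l.
  by rewrite leq_pmull //; lia.
by rewrite mem_box3 /maxc !geq_max => /andP[/andP[-> ->] ->].
Qed.

Lemma height_le (R : realType) (n : nat) (B : R)
    (tv : (int * int * int) * (int * int * int)) :
  (0 < n)%N -> 0 < B -> fibre_data n tv ->
  (height R n (fibre_pt n tv.1 tv.2) <= B) =
  ((lheight n tv.1 tv.2)%:R <= (B `^ n.+2%:R^-1) ^+ n).
Proof.
move=> n0 B0 tvD; rewrite height_fibre_pt //; set L := (lheight _ _ _)%:R.
have L0 : 0 <= L :> R by rewrite ler0n.
set Y := B `^ _; have Y0 : 0 <= Y by apply: powR_ge0.
have nR : n%:R != 0 :> R by rewrite pnatr_eq0 -lt0n.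
have BE : B = (Y ^+ n) `^ (n.+2%:R / n%:R).
  rewrite -powR_mulrn // /Y -!powRrM; set i := (X in _ `^ X).
  have -> : i = 1 by rewrite /i; field; rewrite nR -natrD pnatr_eq0.
  by rewrite powRr1 // ltW.
have Yn0 : 0 <= Y ^+ n by rewrite exprn_ge0.
rewrite {1}BE; case: (leP L (Y ^+ n)) => LY.
  by apply: ge0_ler_powR; rewrite ?nnegrE ?divr_ge0.
apply/negbTE; rewrite -ltNge; apply: gt0_ltr_powR; rewrite ?nnegrE //.
by rewrite divr_gt0 ?ltr0n.
Qed.

(** For [B <= 0], this leaves no points to count in [below_finite]. *)
Lemma height_gt0 (R : realType) (n : nat)
    (tv : (int * int * int) * (int * int * int)) :
  (0 < n)%N -> fibre_data n tv -> 0 < height R n (fibre_pt n tv.1 tv.2).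
Proof.
move=> n0 tvD; rewrite height_fibre_pt // powR_gt0 // ltr0n.
case: tv tvD => t v /and3P[/= Jt /andP[q0 _] _].
rewrite /lheight leq_max; apply/orP; left; rewrite muln_gt0 expn_gt0.
have := normalized_neq0 Jt; rewrite /maxc; lia.
Qed.

Lemma below_eq (R : realType) (n m p : nat) (B : R) :
  (0 < n)%N -> 0 < B -> (B `^ n.+2%:R^-1) ^+ n <= m%:R -> (m <= p)%N ->
  below (Xn_reg n) (@height R n) B =
  [set` [seq fibre_pt n tv.1 tv.2 |
          tv <- bounded_data n p m ((B `^ n.+2%:R^-1) ^+ n)]].
Proof.
move=> n0 B0 Bm mp; apply/seteqP; split=> x /=.
  move=> [/(Xn_regP n0)[tv tvD ->]] /=; rewrite height_le // => hB.
  by apply/mapP; exists tv => //; rewrite mem_bounded_data // tvD.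
move=> /mapP[tv]; rewrite mem_bounded_data // => /andP[tvD hB] ->.
by split; [exact: fibre_pt_reg|rewrite /= height_le].
Qed.

Lemma below_finite (R : realType) (n : nat) (B : R) : (0 < n)%N ->
  finite_set (below (Xn_reg n) (@height R n) B).
Proof.
move=> n0; have [B0|B0] := ltP 0 B.
  pose m := (Num.truncn ((B `^ n.+2%:R^-1) ^+ n)).+1.
  by rewrite (@below_eq R n m m) //; apply/ltW/truncnS_gt.
rewrite (_ : below _ _ _ = set0) //; apply/seteqP; split=> x //.
move=> [/(Xn_regP n0)[tv tvD ->]] /= hB.
by have := lt_le_trans (height_gt0 R n0 tvD) (le_trans hB B0); rewrite ltxx.
Qed.

Lemma NcountE (R : realType) (n m p : nat) (B : R) :
  (0 < n)%N -> 0 < B -> (B `^ n.+2%:R^-1) ^+ n <= m%:R -> (m <= p)%N ->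
  Ncount (Xn_reg n) (@height R n) B =
  (\sum_(t <- box3 p | normalized t)
     primitive_count n t m ((B `^ n.+2%:R^-1) ^+ n))%N.
Proof.
move=> n0 B0 Bm mp; rewrite /Ncount (below_eq n0 B0 Bm mp) -size_bounded_data.
set s := bounded_data _ _ _ _; set r := [seq _ | tv <- s].
have ur : uniq r.
  rewrite map_inj_in_uniq ?bounded_data_uniq // => tv tv'.
  rewrite !mem_bounded_data // => /andP[tvD _] /andP[tvD' _].
  exact: fibre_pt_inj.
have -> : fset_set [set` r] = [fset x in r]%fset.
  apply/fsetP => x; rewrite in_fset_set; last exact: finite_seq.
  by rewrite !inE /= mem_setE.
have := card_fseq r; rewrite undup_id // size_map => <-.
by congr (size (enum_fset _)); apply/fsetP => x; rewrite !inE.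
Qed.

(** * The asymptotic formula *)

(** [primitive_sum_estimate] holds for every box of triples that contains those of
bounded height; letting the box grow replaces the partial sum by [S]. *)
Lemma count_estimate (R : realType) (n : nat) (B S : R) :
  (3 <= n)%N -> 0 < B ->
  (forall p, \sum_(t <- box3 p | normalized t)
     (1 / 2 * (1 / zeta R 2) * omega_pt R n t) <= S) ->
  (forall (e : R) p0, 0 < e -> exists2 p, (p0 <= p)%N &
     S - e < \sum_(t <- box3 p | normalized t)
       (1 / 2 * (1 / zeta R 2) * omega_pt R n t)) ->
  `|(Ncount (Xn_reg n) (@height R n) B)%:R - S * B `^ ((2 * n)%:R / n.+2%:R)| <=
  error_constant R n * n.+1%:R * B.
Proof.
move=> n3 B0 leS advS; have n0 : (0 < n)%N by lia.
set Y := B `^ n.+2%:R^-1; have Y0 : 0 < Y by apply: powR_gt0.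
have nR : n.+2%:R != 0 :> R by rewrite pnatr_eq0.
have BE : Y ^+ n.+2 = B.
  by rewrite -powR_mulrn ?ltW // -powRrM mulVf // powRr1 // ltW.
have B2E : B `^ ((2 * n)%:R / n.+2%:R) = Y ^+ (2 * n).
  by rewrite -powR_mulrn ?ltW // -powRrM mulrC.
rewrite B2E -[in leRHS]BE; set E := leRHS.
pose m := (Num.truncn (Y ^+ n)).+1.
have Ym : Y ^+ n <= m%:R by apply/ltW/truncnS_gt.
set X := Y ^+ (2 * n); have X0 : 0 < X by rewrite exprn_gt0.
apply/ler_addgt0Pr => e e0.
have eX : 0 < e / X by rewrite divr_gt0.
have [p mp Sp] := advS (e / X) m eX.
rewrite (NcountE n0 B0 Ym mp) natr_sum.
have := primitive_sum_estimate p n3 Y0 Ym; rewrite -/E.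
set P := \sum_(t <- _ | _) _; set W := \sum_(t <- _ | _) _ => H.
set V := \sum_(t <- _ | _) _ in Sp.
have VE : (zeta R 2)^-1 * (W / 2 * X) = V * X.
  rewrite /V -mulr_sumr -/W; ring.
rewrite VE in H; have Vle : V <= S := leS p.
have -> : P - S * X = (P - V * X) + (V - S) * X by ring.
apply: le_trans (ler_normD _ _) _; apply: lerD => //.
rewrite normrM (gtr0_norm X0) -ler_pdivlMr // distrC ger0_norm ?subr_ge0 //.
by rewrite lerBlDr -lerBlDl ltW.
Qed.

Theorem theorem1p2 (R : realType) (n : nat) (n_ge3 : (3 <= n)%N) :
  exists omega : set (3.-tuple rat) -> R,
    let cst (x : set (3.-tuple rat)) : R :=
      1 / 2 * (1 / zeta R 2) * omega x in
    [/\ (forall (x : set (3.-tuple rat)) (a c z : int),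
          P2_minus x -> coprime_coords x a c z ->
          (a != 0 -> omega x = omega_a n a%:~R c%:~R z%:~R) /\
          (c != 0 -> omega x = omega_c n a%:~R c%:~R z%:~R)),
        summable P2_minus (fun x => (cst x)%:E),
        (forall B : R, finite_set (below (Xn_reg n) (@height R n) B)) &
        (fun B : R => (Ncount (Xn_reg n) (@height R n) B)%:R : R) =
          (fun B : R => fine (\esum_(x in P2_minus) (cst x)%:E) *
                        B `^ ((2 * n)%:R / n.+2%:R))
          +O_ (pinfty_nbhs R) (fun B : R => B)].
Proof.
have n0 : (0 < n)%N by lia.
(* The default value of [xget] is only taken outside [P2_minus]. *)
pose pt (x : set (3.-tuple rat)) :=
  xget ((0, 0), 0) [set t | normalized t /\ plane_pt t = x].
have ptK t : normalized t -> pt (plane_pt t) = t.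
  move=> Jt; have [Jt' e] := @xgetI _ ((0, 0), 0)
    [set t' | normalized t' /\ plane_pt t' = plane_pt t] t (conj Jt erefl).
  exact: plane_pt_inj.
exists (fun x => omega_pt R n (pt x)) => cst.
have z0 : 0 < zeta R 2 by apply: lt_le_trans (zeta2_ge1 R).
pose f (t : int * int * int) : R := 1 / 2 * (1 / zeta R 2) * omega_pt R n t.
have f0 t : 0 <= f t.
  by rewrite /f !mulr_ge0 ?invr_ge0 ?omega_pt_ge0 // ltW.
have fC p : \sum_(t <- box3 p | normalized t) f t <= 1 / 2 * (1 / zeta R 2) * 1536.
  rewrite -mulr_sumr ler_wpM2l ?omega_pt_sum_le //.
  by rewrite !mulr_ge0 ?invr_ge0 // ltW.
have [S [SE leS advS]] := esum_box (fun t _ => f0 t) fC.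
have esumE : (\esum_(x in P2_minus) (cst x)%:E)%E = S%:E.
  rewrite (@reindex_esum R _ _ _ _ _ (fun x => (cst x)%:E) plane_pt_bij) -SE.
  apply: eq_esum => t Jt.
  by rewrite /cst ptK.
split.
- move=> x a c z xP cop.
  have [_ _ surj] := plane_pt_bij; have [t Jt tx] := surj _ xP.
  rewrite -{}tx in cop *; rewrite ptK //.
  have [ea ec ez] := coprime_coords_normalized Jt cop.
  split=> [a0|c0].
    by rewrite omega_aE // ea ec ez /omega_pt ifT //; lia.
  rewrite omega_cE // ea ec ez /omega_pt; case: ifPn => // t0.
  by rewrite omega_natC //; lia.
- rewrite /summable; have -> : \esum_(x in P2_minus) `|(cst x)%:E|%E =
    \esum_(x in P2_minus) (cst x)%:E; last by rewrite esumE ltry.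
  apply: eq_esum => x _; rewrite gee0_abs // lee_fin.
  exact: f0.
- by move=> B; exact: below_finite.
- rewrite esumE /=; apply/eqaddOP.
  near=> k; near=> B.
  have B0 : 0 < B by near: B; apply: nbhs_pinfty_gt.
  apply: le_trans (count_estimate n_ge3 B0 leS advS) _.
  rewrite (gtr0_norm B0) ler_wpM2r ?(ltW B0) //.
Unshelve. all: by end_near. Qed.
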